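(* Let $\mathbb{L}=(\mathcal{P},\mathcal{C},\parallel)$ be a Laguerre plane satisfying axioms (C) and (S), and let $K,L$ be circles which are not tangent. Then there exists an involutory automorphism $\phi$ of $\mathbb{L}$ such that (1) $\phi(x)=xKL$ for all $x\in K$; and (2) for every point $x$ with $\phi(x)\neq x$ and every circle $M$ containing both $x$ and $\phi(x)$, we have $\phi(M)=M$.
   Context: A Laguerre plane is a triple $(\mathcal{P},\mathcal{C},\parallel)$ where $\mathcal{P}$ is a set of points, $\mathcal{C}\subset 2^{\mathcal{P}}$ a set of circles and $\parallel$ an equivalence relation on $\mathcal{P}$ (parallelism; its classes are called generators) such that: (1) any three pairwise non-parallel points lie on a unique circle; (2) for every circle $K$ and non-parallel points $p\in K$, $q\notin K$ there is exactly one circle $L$ with $q\in L$ and $K\cap L=\{p\}$; (3) for every point $p$ and circle $K$ there is exactly one point $q\in K$ with $q\parallel p$; (4) some circle contains at least three but not all points. Circles $K,L$ are tangent at $p$ if $K\cap L=\{p\}$ or $K=L$ (with $p\in K$); they are tangent if tangent at some point. For $p\in K$, $\langle p,K\rangle$ denotes the set of circles tangent to $K$ at $p$. Axiom (C): for any circles $K,L$ and any point $p\in K\setminus L$ there exists exactly one circle $M\in\langle p,K\rangle$ with $|M\cap L|=1$. Axiom (S): if $K,L,M,N$ are circles and $a,b,c,d$ points with $K\cap L=\{a\}$, $L\cap M=\{b\}$, $M\cap N=\{c\}$, $N\cap K=\{d\}$ and $a\nparallel c$, then there is a circle containing $a,b,c,d$. Notation: for distinct circles $K,L$ and $x\in K\setminus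 L$, let $M$ be the unique circle of $\langle x,K\rangle$ with $|M\cap L|=1$ given by (C); then $xKL$ denotes the unique point of $M\cap L$. For $x\in K\cap L$, $xKL:=x$. An automorphism of $\mathbb{L}$ is a bijection of $\mathcal{P}$ mapping the set of circles onto itself; it is involutory if its square is the identity. *)

(* Defs.v *)
(* A Laguerre plane is given by a type of points P, a type of
   circles C with an incidence relation inc (circles are determined by their
   point sets, i.e. C is a subset of 2^P), and a parallelism relation par. *)
From Stdlib Require Import Classical.
Set Implicit Arguments.

Section Laguerre.
Variables (P C : Type) (par : P -> P -> Prop) (inc : P -> C -> Prop).

Definition meet_single (K L : C) (p : P) : Prop :=
  forall z, (inc z K /\ inc z L) <-> z = p.

Definition tangent_at (p : P) (K L : C) : Prop :=
  meet_single K L p \/ (K = L /\ inc p K).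

Definition tangent (K L : C) : Prop := exists p, tangent_at p K L.

Definition in_pencil (p : P) (K M : C) : Prop := inc p K /\ tangent_at p K M.

Definition meet_one (M L : C) : Prop := exists! z, inc z M /\ inc z L.

Record laguerre_plane : Prop := {
  lp_par_refl : forall p, par p p;
  lp_par_sym : forall p q, par p q -> par q p;
  lp_par_trans : forall p q r, par p q -> par q r -> par p r;
  lp_ext : forall K L : C, (forall p, inc p K <-> inc p L) -> K = L;
  lp_ax1 : forall a b c, ~ par a b -> ~ par b c -> ~ par a c ->
             exists! K, inc a K /\ inc b K /\ inc c K;
  lp_ax2 : forall K p q, inc p K -> ~ inc q K -> ~ par p q ->
             exists! L, inc q L /\ meet_single K L p;
  lp_ax3 : forall p K, exists! q, inc q K /\ par q p;
  lp_ax4 : exists K, (exists a b c, a <> b /\ b <> c /\ a <> c /\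
                        inc a K /\ inc b K /\ inc c K)
                     /\ (exists p, ~ inc p K)
}.

Definition axiom_C : Prop :=
  forall K L p, inc p K -> ~ inc p L ->
    exists! M, in_pencil p K M /\ meet_one M L.

Definition axiom_S : Prop :=
  forall (K L M N : C) (a b c d : P),
    meet_single K L a -> meet_single L M b -> meet_single M N c ->
    meet_single N K d -> ~ par a c ->
    exists O, inc a O /\ inc b O /\ inc c O /\ inc d O.

(* y = xKL  (for distinct circles K, L and x ∈ K).  If x ∈ L then xKL = x;
   otherwise y is the unique point of M ∩ L, where M is the (unique, by (C))
   circle of <x,K> with |M ∩ L| = 1. *)
Definition is_xKL (K L : C) (x y : P) : Prop :=
  (inc x L /\ y = x) \/
  (~ inc x L /\ exists M, in_pencil x K M /\ meet_single M L y).

Definition circle_image (f : P -> P) (M M' : C) : Prop :=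
  forall y, inc y M' <-> exists x, inc x M /\ f x = y.

Definition automorphism (f : P -> P) : Prop :=
  (forall x y, f x = f y -> x = y) /\ (forall y, exists x, f x = y) /\
  (forall M, exists M', circle_image f M M') /\
  (forall M', exists M, circle_image f M M').

Definition involutory (f : P -> P) : Prop := forall x, f (f x) = x.

Definition fixes_circle (f : P -> P) (M : C) : Prop := circle_image f M M.

End Laguerre.

(* Main.v *)
Require Import Defs.
From Stdlib Require Import Classical ClassicalEpsilon Arith Lia List.
Set Implicit Arguments.

(** Axiom (C) forbids three circles that touch pairwise in different points. Together with (S) this
    closes parallelograms of touching circles and makes well defined the "null translation" that
    pushes every circle along one generator [h] in the same way. The null translations generate
    an abelian group acting regularly on the circles, so the circles form a group [V] with subgroups
    [T i] (circles touching the zero circle on the generator [i]) and [E i] (circles meeting it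
    there). In the model of a Miquelian plane, [V] is a Lorentzian 3-space, the [T i] are its null
    lines and the [E i] the corresponding null planes.

    For [a <> b] one has [V = T a + T b + U] with [U] the intersection of [E a] and [E b], and (S)
    says that for [n + m + t] in [T g] the element [d] of [U] with [n + d] in [E g] depends on [t]
    only; comparing several choices of [b] gives [d + d = t]. It follows that in suitable
    coordinates the other [T g] are the sets [{(g t, g^-1 t, t)}] for a commuting, sharply
    transitive family of operators [g] on [U]. Put [K] at the origin. If [L = (p, q, 0)] and [c] is
    the operator mapping [-q] to [p], the wanted automorphism is the reflection
    [(x, y, z) |-> (c y, c^-1 x, z) + L]; on generators it is [g |-> c g^-1]. *)

(** * Abelian groups *)

Record abgroup (V : Type) := {
  gz : V; ga : V -> V -> V; go : V -> V;
  ga_assoc : forall x y z, ga x (ga y z) = ga (ga x y) z;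
  ga_comm : forall x y, ga x y = ga y x;
  ga_0 : forall x, ga gz x = x;
  ga_opp : forall x, ga x (go x) = gz
}.

(** * A reflective decision procedure for equations in abelian groups *)

Inductive gexp := GZ | GV (n : nat) | GA (a b : gexp) | GO (a : gexp).

(** Positive and negative occurrences are counted separately, so that multiplicities stay in
    [nat]. *)
Fixpoint gpos (e : gexp) (n : nat) : nat :=
  match e with
  | GZ => 0 | GV m => if Nat.eqb m n then 1 else 0
  | GA a b => gpos a n + gpos b n | GO a => gneg a n end
with gneg (e : gexp) (n : nat) : nat :=
  match e with
  | GZ | GV _ => 0 | GA a b => gneg a n + gneg b n | GO a => gpos a n end.

Fixpoint gbelow (e : gexp) (b : nat) : bool :=
  match e with
  | GZ => true | GV m => Nat.ltb m b
  | GA x y => andb (gbelow x b) (gbelow y b) | GO x => gbelow x b end.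

Section Abel.
Variables (V : Type) (G : abgroup V).
Local Notation "x + y" := (ga G x y).
Local Notation "- x" := (go G x).
Local Notation "0" := (gz G).

Lemma ga_0r x : x + 0 = x.
Proof. now rewrite ga_comm, ga_0. Qed.

Lemma ga_cancel x y z : x + z = y + z -> x = y.
Proof.
intros H. rewrite <- (ga_0r x), <- (ga_0r y), <- (ga_opp G z), !ga_assoc. now rewrite H.
Qed.

Lemma ga_swap x y z t : (x + y) + (z + t) = (x + z) + (y + t).
Proof. now rewrite !ga_assoc, <- (ga_assoc G x y z), (ga_comm G y z), ga_assoc. Qed.

Variable env : nat -> V.

Fixpoint geval (e : gexp) : V :=
  match e with
  | GZ => 0 | GV n => env n | GA a b => geval a + geval b | GO a => - geval a end.

Fixpoint gmul (n : nat) (x : V) : V := match n with O => 0 | S n => x + gmul n x end.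

Fixpoint gsum (c : nat -> nat) (b : nat) : V :=
  match b with O => 0 | S b => gmul (c b) (env b) + gsum c b end.

Lemma gmul_add m n x : gmul (Nat.add m n) x = gmul m x + gmul n x.
Proof. induction m as [|m IH]; simpl; [now rewrite ga_0|now rewrite IH, ga_assoc]. Qed.

Lemma gsum_add c d b : gsum (fun n => Nat.add (c n) (d n)) b = gsum c b + gsum d b.
Proof.
induction b as [|b IH]; simpl; [now rewrite ga_0|].
now rewrite gmul_add, IH, ga_swap.
Qed.

Lemma gsum_0 b : gsum (fun _ => O) b = 0.
Proof. induction b as [|b IH]; simpl; auto. now rewrite ga_0. Qed.

Lemma gsum_ext c d b : (forall n, n < b -> c n = d n) -> gsum c b = gsum d b.
Proof.
induction b as [|b IH]; simpl; auto. intros H. rewrite H, IH; auto with arith.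
Qed.

Lemma gsum_var m b : m < b -> gsum (fun n => if Nat.eqb m n then 1 else O) b = env m.
Proof.
induction b as [|b IH]; simpl; [lia|]. intros H.
destruct (Nat.eqb_spec m b) as [->|nb]; simpl.
- rewrite ga_0r, (@gsum_ext _ (fun _ => O)), gsum_0, ga_0r; auto.
  intros n Hn. destruct (Nat.eqb_spec b n); lia.
- rewrite ga_0. apply IH. lia.
Qed.

(** Negative occurrences are moved to the other side; under [GO] the two counts trade places. *)
Lemma geval_sum e b : gbelow e b = true -> geval e + gsum (gneg e) b = gsum (gpos e) b.
Proof.
induction e as [|m|x IHx y IHy|x IHx]; simpl; intros H.
- now rewrite gsum_0, ga_0.
- apply Nat.ltb_lt in H. now rewrite gsum_0, ga_0r, gsum_var.
- apply Bool.andb_true_iff in H as [Hx Hy].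
  change (geval x + geval y + gsum (fun n => Nat.add (gneg x n) (gneg y n)) b
    = gsum (fun n => Nat.add (gpos x n) (gpos y n)) b).
  now rewrite !gsum_add, ga_swap, IHx, IHy.
- change (- geval x + gsum (gpos x) b = gsum (gneg x) b).
  rewrite <- IHx by auto. now rewrite ga_assoc, (ga_comm G (- _)), ga_opp, ga_0.
Qed.

Lemma geval_eq e f b : gbelow e b = true -> gbelow f b = true ->
  forallb (fun n => Nat.eqb (gpos e n + gneg f n) (gpos f n + gneg e n)) (seq 0 b) = true ->
  geval e = geval f.
Proof.
intros He Hf H.
apply (@ga_cancel _ _ (gsum (gneg e) b + gsum (gneg f) b)).
rewrite ga_assoc, geval_sum, (ga_comm G (gsum (gneg e) b)), ga_assoc, geval_sum by auto.
rewrite <- !gsum_add. apply gsum_ext. intros n Hn.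
apply Nat.eqb_eq. rewrite forallb_forall in H. apply H, in_seq. lia.
Qed.
End Abel.

Ltac gfind x l :=
  match l with
  | cons x _ => constr:(O)
  | cons _ ?l' => let n := gfind x l' in constr:(S n)
  end.
Ltac gvars G t l :=
  lazymatch t with
  | gz G => l
  | ga G ?a ?b => let l1 := gvars G a l in gvars G b l1
  | go G ?a => gvars G a l
  | _ => match l with
         | _ => let _ := gfind t l in l
         | _ => constr:(cons t l)
         end
  end.
Ltac gquote G t l :=
  lazymatch t with
  | gz G => constr:(GZ)
  | ga G ?a ?b => let x := gquote G a l in let y := gquote G b l in constr:(GA x y)
  | go G ?a => let x := gquote G a l in constr:(GO x)
  | _ => let n := gfind t l in constr:(GV n)
  end.
Ltac abel G :=
  lazymatch goal with
  | |- @eq ?V ?x ?y =>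
    let l0 := constr:(@nil V) in
    let l1 := gvars G x l0 in
    let l := gvars G y l1 in
    let a := gquote G x l in
    let b := gquote G y l in
    let n := eval compute in (length l) in
    change (geval G (fun k => nth k l (gz G)) a = geval G (fun k => nth k l (gz G)) b);
    apply (@geval_eq V G (fun k => nth k l (gz G)) a b n); reflexivity
  end.

(** * Tangency of circles and null translations *)

Section Abs.
Variables (C I : Type) (e : I -> C -> C -> Prop).

(* [I] is the set of generators and [e i X Y] says that the circles [X] and [Y] have the same point
   on [i]; a point of the plane is thus a class of [e i]. A circle touches itself everywhere. *)
Definition touch i X Y := e i X Y /\ (X = Y \/ forall j, e j X Y -> j = i).

Local Notation N := touch.

(** The plane axioms with points eliminated: a point is named by its generator and a circle through
    it. The field [fresh] provides four generators; [agree_fresh] derives it from the geometry. *)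
Record circle_space : Prop := {
  e_refl : forall i X, e i X X;
  e_sym : forall i X Y, e i X Y -> e i Y X;
  e_trans : forall i X Y Z, e i X Y -> e i Y Z -> e i X Z;
  inh : inhabited I;
  fresh : forall i j k : I, exists l, l <> i /\ l <> j /\ l <> k;
  A1ex : forall i j k X Y Z, i <> j -> j <> k -> i <> k ->
    exists W, e i W X /\ e j W Y /\ e k W Z;
  A1un : forall i j k X Y, i <> j -> j <> k -> i <> k ->
    e i X Y -> e j X Y -> e k X Y -> X = Y;
  A2ex : forall i j X Y, i <> j -> exists W, N i X W /\ e j W Y;
  A2un : forall i j X W W', i <> j -> N i X W -> N i X W' -> e j W W' -> W = W';
  Cex : forall i X Y, ~ e i X Y -> exists W j, N i X W /\ N j W Y;
  Cun : forall i j j' X Y W W', ~ e i X Y -> N i X W -> N j W Y ->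
    N i X W' -> N j' W' Y -> W = W';
  Sax : forall a b c d K L M X, K <> L -> L <> M -> M <> X -> X <> K ->
    N a K L -> N b L M -> N c M X -> N d X K -> a <> c ->
    exists O, e a O K /\ e b O L /\ e c O M /\ e d O X
}.

Hypothesis A : circle_space.

Let er := e_refl A.
Let es := e_sym A.
Let et := e_trans A.

(** * Chains of touching circles *)

Lemma N_refl i X : N i X X.
Proof. split; auto. Qed.

Lemma N_sym i X Y : N i X Y -> N i Y X.
Proof. intros [H [->|H1]]; split; auto. Qed.

Lemma N_e i X Y : N i X Y -> e i X Y.
Proof. now intros [H _]. Qed.

Lemma N_ne i j X Y : N i X Y -> e j X Y -> i <> j -> X = Y.
Proof. intros [_ [H|H]] Hj Hij; auto. now elim Hij; rewrite (H j Hj). Qed.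

Lemma N_inj i j X Y : N i X Y -> N j X Y -> i <> j -> X = Y.
Proof. intros H H'; exact (N_ne H (N_e H')). Qed.

Lemma N_trans i X Y Z : N i X Y -> N i Y Z -> N i X Z.
Proof.
intros H1 H2; split. { eapply et; apply N_e; eauto. }
destruct (classic (X = Z)) as [|Hn]; [now left|right; intros j Hj].
apply NNPP; intro Hne; apply Hn.
apply (A2un A (i := i) (j := j) (X := Y)); auto using N_sym.
Qed.

(** Otherwise [X] and [Y] would be two circles of one pencil on [i] that both touch [Z], against the
    uniqueness in (C). *)
Lemma no_triangle i j k X Y Z : N i X Y -> N j Y Z -> N k X Z -> i <> j -> X = Y \/ Y = Z.
Proof.
intros H1 H2 H3 Hij.
destruct (classic (e i Y Z)) as [H|H].
- right. eapply N_ne; eauto.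
- left. apply (Cun A (i := i) (j := k) (j' := j) (X := X) (Y := Z)); auto using N_refl.
  intro H'; apply H. eapply et; [apply es, N_e|]; eauto.
Qed.

(** By (C) some [K'] touches [L] on [g] and also touches [X]. Once the second contact is seen to lie
    on [h], [K' = K] follows. *)
Lemma parallelogram g h M X L K : g <> h -> N g M X -> N h M L -> N h X K -> e g K L -> N g L K.
Proof.
intros Hgh HMX HML HXK HKL.
destruct (classic (M = X)) as [<-|nMX].
{ assert (K = L) as -> by (apply (A2un A (i := h) (j := g) (X := M)); auto).
  apply N_refl. }
destruct (classic (M = L)) as [<-|nML].
{ assert (K = X) as ->; auto.
  apply (A2un A (i := h) (j := g) (X := X)); auto using N_refl.
  eapply et; [eassumption|apply N_e; assumption]. }
assert (nLX : ~ e g L X).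
{ intro H; apply nML. eapply (N_ne (i := h) (j := g)); eauto.
  eapply et; [apply N_e, HMX|apply es, H]. }
destruct (Cex A nLX) as (K' & j & H1 & H2).
assert (K' <> L).
{ intros ->. destruct (no_triangle (N_sym HMX) HML (N_sym H2) Hgh); congruence. }
assert (K' <> X).
{ intros ->. now apply nLX, N_e. }
destruct (classic (j = h)) as [->|nj].
- assert (K' = K) as <-; auto.
  apply (A2un A (i := h) (j := g) (X := X)); auto using N_sym.
  apply es. eapply et; [eassumption|apply N_e; assumption].
(* The contacts lie on [h], [g], [j], [g], so (S) would give a circle [O] sharing its point on [g]
   with both [L] and [X]. *)
- exfalso. destruct (Sax A nML (b:=g) (c:=j) (a:=h) (d:=g) (M:=K') (X:=X)) as (O & O1 & O2 & O3 & O4);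
   auto using N_sym.
  apply nLX. eapply et; [apply es|]; eauto.
Qed.

(** A converse to (S). A closing circle [X'] comes from (C), and by (S) its contact with [K] lies on
    [O], since [O] is determined by the other three contacts. *)
Lemma quad_close a b c d O K L M X :
  a <> b -> a <> c -> a <> d -> b <> c -> b <> d -> c <> d ->
  N a K L -> N b L M -> N c M X ->
  e a O K -> e d O K -> e b O L -> e c O M -> e d O X -> N d X K.
Proof.
intros ab ac ad bc bd cd HKL HLM HMX OaK OdK ObL OcM OdX.
assert (OaL : e a O L) by (eapply et; [|apply N_e]; eauto).
assert (ObM : e b O M) by (eapply et; [|apply N_e]; eauto).
assert (OcX : e c O X) by (eapply et; [|apply N_e]; eauto).
destruct (classic (O = K)) as [<-|nOK].
{ assert (O = L) as <- by exact (N_ne HKL ObL ab).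
  assert (O = M) as <- by exact (N_ne HLM OcM bc).
  assert (O = X) as <- by exact (N_ne HMX OdX cd).
  apply N_refl. }
assert (nKL : K <> L).
{ intros <-. apply nOK. apply (A1un A ab bd ad); auto. }
assert (nOL : O <> L).
{ intros <-. apply nOK. symmetry. apply (N_ne HKL (es OdK) ad). }
assert (nLM : L <> M).
{ intros <-. apply nOL. apply (A1un A ab bc ac); auto. }
assert (ncMK : ~ e c M K).
{ intro H. apply nOK. apply (A1un A ac cd ad); auto. eapply et; eauto. }
destruct (Cex A ncMK) as (X' & d' & H1 & H2).
assert (nMX : M <> X').
{ intros <-. destruct (no_triangle HKL HLM (N_sym H2) ab); congruence. }
assert (nXK : X' <> K).
{ intros ->. now apply ncMK, N_e. }
destruct (Sax A nKL nLM nMX nXK HKL HLM H1 H2 ac) as (O' & O1 & O2 & O3 & O4).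
assert (O' = O) as ->.
{ apply (A1un A ab bc ac); eapply et; eauto. }
assert (Hd : e d' O K) by (eapply et; [|apply N_e]; eauto).
(* [O] meets [K] on [a], [d] and [d']; three distinct generators would force [O = K], and [d' = a]
   makes a triangle of contacts. *)
destruct (classic (d' = d)) as [->|nd].
- assert (X = X') as ->; auto.
  apply (A2un A cd HMX H1). eapply et; eauto.
- exfalso. destruct (classic (d' = a)) as [->|na].
  + assert (H3 : N a L X') by (apply N_sym; eapply N_trans; eauto).
    destruct (no_triangle HLM H1 H3 bc); congruence.
  + apply nOK. apply (A1un A (i:=a) (j:=d) (k:=d')); auto.
Qed.

(** The auxiliary circle [O] is chosen first, to carry all four contacts. This quadrangle later
    decomposes [T j] along three other generators. *)
Lemma quad_exists j a b g X Y : j <> a -> j <> b -> j <> g -> a <> b -> a <> g -> b <> g ->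
  N j X Y -> exists Z W, N a Y Z /\ N b Z W /\ N g W X.
Proof.
intros ja jb jg ab ag bg H.
destruct (A1ex A X X Y jg (not_eq_sym ag) ja) as (O & O1 & O2 & O3).
destruct (A2ex A Y O ab) as (Z & Z1 & Z2).
destruct (A2ex A Z O bg) as (W & W1 & W2).
exists Z, W; repeat split; try apply Z1; try apply W1.
all: apply (@quad_close j a b g O X Y Z W); auto.
Qed.

(* Let [Q] be the circle through the points of [M2] on [g], [k] and of [O] on [h]. If [Q] met [O]
   again on [x], push the chain of touching circles [M T B D] around [O] along [h]: by (S) its
   image would still touch [Q] on [x], though null translation moves that point. *)
Lemma transport h g k M O M2 O2 : h <> g -> h <> k -> N h M M2 -> N h O O2 ->
  e g M O -> e k M O -> e g M2 O2 -> e k M2 O2.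
Proof.
intros hg hk HM HO HgMO HkMO Hg2.
destruct (classic (g = k)) as [<-|gk]; auto.
destruct (classic (M = O)) as [<-|nMO].
{ assert (M2 = O2) as <-; auto. eapply (A2un A hg); eauto. }
destruct (classic (M = M2)) as [<-|nM2].
{ assert (O2 = O) as ->; auto.
  apply (A2un A hg HO (N_refl _ _)). eapply et; [|eauto]. auto. }
destruct (A1ex A O M2 M2 hg gk hk) as (Q & Qh & Qg & Qk).
assert (HQ : N h O Q).
{ split; auto. right. intros x Hx. apply NNPP; intro nx.
  assert (xg : x <> g).
  { intros ->. exact (nM2 (N_ne HM (et HgMO (et Hx Qg)) hg)). }
  assert (xk : x <> k).
  { intros ->. exact (nM2 (N_ne HM (et HkMO (et Hx Qk)) hk)). }
  destruct (A2ex A M O (not_eq_sym xk)) as (T & T1 & T2).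
  destruct (A2ex A T O nx) as (B & B1 & B2).
  destruct (A2ex A B O hg) as (D & D1 & D2).
  assert (D3 : N g D M).
  { apply (@quad_close k x h g O M T B D); auto. }
  destruct (A2ex A M2 T (not_eq_sym hk)) as (T' & T'1 & T'2).
  pose proof (parallelogram hk HM T1 T'1 T'2) as HT.
  destruct (A2ex A T' B nx) as (B' & B'1 & B'2).
  pose proof (parallelogram (not_eq_sym nx) HT B1 B'1 B'2) as HB.
  destruct (A2ex A M2 D (not_eq_sym hg)) as (D' & D'1 & D'2).
  pose proof (parallelogram hg HM (N_sym D3) D'1 D'2) as HD.
  assert (HBD : N h B' D').
  { exact (N_trans (N_sym HB) (N_trans D1 HD)). }
  assert (nMT : M <> T).
  { intros <-. apply nMO. apply (A1un A gk (not_eq_sym xk) (not_eq_sym xg)); auto. }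
  assert (nTO : T <> O).
  { intros ->. apply nMO. apply (N_ne T1 HgMO). auto. }
  pose proof (et (es (N_e T1)) HkMO) as eTO.
  assert (nTB : T <> B).
  { intros <-. apply nTO. apply (A1un A hk (not_eq_sym xk) (not_eq_sym nx)); auto. }
  assert (nBD : B <> D).
  { intros <-. apply nTO. apply (N_ne (i := x) (j := k)); auto.
    assert (B = O) as <-; auto.
    apply (A1un A hg (not_eq_sym xg) (not_eq_sym nx)); auto.
    exact (et (es (N_e B1)) T2). }
  assert (nDM : D <> M).
  { intros ->. apply nMO. apply (A1un A hg gk hk); auto. exact (et (es (N_e D1)) B2). }
  assert (nM2T : M2 <> T').
  { intros ->. apply nMT. exact (N_inj T1 (N_trans HM (N_sym HT)) (not_eq_sym hk)). }
  assert (nT'B : T' <> B').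
  { intros <-. apply nTB. exact (N_inj B1 (N_trans HT (N_sym HB)) nx). }
  assert (nD'M : D' <> M2).
  { intros ->. apply nDM. exact (N_inj D3 (N_trans HD (N_sym HM)) (not_eq_sym hg)). }
  assert (nBD' : B' <> D').
  { intros <-. destruct (no_triangle T'1 B'1 D'1 (not_eq_sym xk)); congruence. }
  destruct (Sax A nM2T nT'B nBD' nD'M T'1 B'1 HBD (N_sym D'1) (not_eq_sym hk))
    as (O' & O1 & O3 & O4 & O5).
  assert (Q = O') as ->.
  { apply (A1un A hg gk hk).
    - exact (et Qh (et (es B2) (et (N_e HB) (es O4)))).
    - exact (et Qg (et (N_e D'1) (es O5))).
    - exact (et Qk (es O1)). }
  assert (T = T') as <- by exact (N_ne HT (et T2 (et Hx O3)) (not_eq_sym nx)).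
  exact (nM2 (N_inj HM (N_trans T1 (N_sym T'1)) hk)). }
assert (O2 = Q) as ->.
{ exact (A2un A hg HO HQ (et (es Hg2) (es Qg))). }
now apply es.
Qed.

(* Meeting is definable from touching, so a map preserving the latter preserves the former. *)
Lemma e_from_N i X Y :
  e i X Y <-> N i X Y \/ ~ exists W j, j <> i /\ W <> Y /\ N i X W /\ N j W Y.
Proof.
split.
- intros H. right. intros (W & j & ji & WY & H1 & H2). apply WY.
  exact (N_ne H2 (et (es (N_e H1)) H) ji).
- intros [H|H]; [now apply N_e|]. apply NNPP; intros He. apply H.
  destruct (Cex A He) as (W & j & H1 & H2). exists W, j; repeat split; try apply H1; try apply H2.
  + intros ->. apply He. exact (et (N_e H1) (N_e H2)).
  + intros ->. now apply He, N_e.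
Qed.

(** * Null translations *)

Definition null_map h (f : C -> C) :=
  (forall Y, N h Y (f Y)) /\ (forall k Y W, e k Y W -> e k (f Y) (f W)).

(* Parallel transport along [h] of the step from [X] to [X'], possible for circles that meet [X]
   off [h]. *)
Definition moved h X X' Y Y' :=
  N h X X' /\ N h Y Y' /\ exists g, g <> h /\ e g X Y /\ e g X' Y'.

Lemma moved_e h X X' Y Y' k : moved h X X' Y Y' -> e k X Y -> e k X' Y'.
Proof.
intros (H1 & H2 & g & gh & H3 & H4) H.
destruct (classic (h = k)) as [<-|hk].
- exact (et (es (N_e H1)) (et H (N_e H2))).
- exact (transport (not_eq_sym gh) hk H1 H2 H3 H H4).
Qed.

Lemma moved_exists h X X' Y g : g <> h -> N h X X' -> e g X Y -> exists Y', moved h X X' Y Y'.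
Proof.
intros gh HX HXY. destruct (A2ex A Y X' (not_eq_sym gh)) as (Y' & H1 & H2).
exists Y'; split; auto; split; auto; exists g; auto.
Qed.

(** Transport does not depend on the path around a triangle of circles; from this local consistency
    the global null map is glued. *)
Lemma moved_triangle h k X X' Y Y' Z Z' : k <> h ->
  moved h X X' Y Y' -> moved h X X' Z Z' -> e k Y Z -> moved h Y Y' Z Z'.
Proof.
intros kh HY HZ HYZ.
pose proof HY as (HX & HY1 & g & gh & g1 & g2).
pose proof HZ as (_ & HZ1 & l & lh & l1 & l2).
split; auto; split; auto; exists k; repeat split; auto.
destruct (classic (k = g)) as [->|kg].
{ exact (et (es g2) (moved_e HZ (et g1 HYZ))). }
destruct (classic (k = l)) as [->|kl].
{ exact (et (es (moved_e HY (et l1 (es HYZ)))) l2). }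
destruct (classic (g = l)) as [->|gl].
{ apply (@moved_e h Y Y' Z Z'); auto. split; auto; split; auto; exists l; repeat split; auto.
  - exact (et (es g1) l1).
  - exact (et (es g2) l2). }
(* [V] meets [X] on [g] and [l], and passes through the common point of [Y] and [Z] on [k]; its
   image [V'] therefore ties [Y'] to [Z']. *)
destruct (A1ex A X X Y gl (not_eq_sym kl) (not_eq_sym kg)) as (V & V1 & V2 & V3).
destruct (moved_exists gh HX (es V1)) as (V' & HV).
assert (HVY : moved h V V' Y Y').
{ split; [apply HV|]; split; auto; exists g; repeat split; auto.
  - exact (et V1 g1).
  - exact (et (es (moved_e HV (es V1))) g2). }
assert (HVZ : moved h V V' Z Z').
{ split; [apply HV|]; split; auto; exists l; repeat split; auto.
  - exact (et V2 l1).
  - exact (et (es (moved_e HV (es V2))) l2). }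
exact (et (es (moved_e HVY V3)) (moved_e HVZ (et V3 HYZ))).
Qed.

Lemma mediator h k X Y : k <> h -> exists Z g, g <> h /\ g <> k /\ e g X Z /\ e k Z Y.
Proof.
intros kh. destruct (fresh A h k k) as (g & gh & gk & _).
destruct (A1ex A X Y X gk kh gh) as (Z & Z1 & Z2 & _).
exists Z, g; repeat split; auto.
Qed.

(** Equality of values spreads between circles that meet off [h], and [mediator] links any two
    circles by two such steps. *)
Lemma null_map_unique h f g X : null_map h f -> null_map h g -> f X = g X -> forall Y, f Y = g Y.
Proof.
intros [f1 f2] [g1 g2] HX.
assert (H : forall k X Y, k <> h -> f X = g X -> e k X Y -> f Y = g Y).
{ intros k X0 Y kh H0 HY. apply (A2un A (not_eq_sym kh) (f1 Y) (g1 Y)).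
  apply (et (es (f2 _ _ _ HY))). rewrite H0. auto. }
intros Y. destruct (fresh A h h h) as (k & kh & _).
destruct (mediator X Y kh) as (Z & l & lh & _ & l1 & l2).
apply (H k Z); auto. now apply (H l X).
Qed.

Lemma null_map_exists_fwd h X X' : N h X X' -> exists f, null_map h f /\ f X = X'.
Proof.
intros HX.
(* Two transports reach every circle. What remains is that the result does not depend on the
   intermediate [Z]. *)
set (P Y Y' := exists Z Z', moved h X X' Z Z' /\ moved h Z Z' Y Y').
assert (Pex : forall Y, exists Y', P Y Y').
{ intros Y. destruct (fresh A h h h) as (k & kh & _).
  destruct (mediator X Y kh) as (Z & l & lh & _ & l1 & l2).
  destruct (moved_exists lh HX l1) as (Z' & HZ).
  destruct (moved_exists kh (proj1 (proj2 HZ)) l2) as (Y' & HY).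
  exists Y', Z, Z'; auto. }
assert (Pk : forall k Y Y' W W', k <> h -> P Y Y' -> P W W' -> e k Y W -> e k Y' W').
{ assert (P1 : forall k l Y Y' Z Z', k <> h -> l <> h -> l <> k -> moved h X X' Z Z' ->
     e l X Z -> e k Z Y -> P Y Y' -> e k Z' Y').
  { intros k l Y Y' Z Z' kh lh lk HZ Z1 Z2 (T & T' & HT & HY).
    pose proof HY as (_ & _ & m & mh & m1 & m2).
    destruct (classic (m = k)) as [->|mk].
    { apply (et (moved_e (moved_triangle kh HZ HT (et Z2 (es m1))) (et Z2 (es m1)))); auto. }
    destruct (fresh A h k m) as (r & rh & rk & rm).
    (* [V] meets [X] on the fresh [r] and [Y] on both [k] and [m], so it is comparable with [Z]
       through [k] and with [T] through [m]. *)
    destruct (A1ex A X Y Y rk (not_eq_sym mk) rm) as (V & V1 & V2 & V3).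
    destruct (moved_exists rh HX (es V1)) as (V' & HV).
    assert (HTV : moved h T T' V V').
    { apply (moved_triangle mh HT HV (et m1 (es V3))). }
    assert (HZV : moved h Z Z' V V').
    { apply (moved_triangle kh HZ HV (et Z2 (es V2))). }
    assert (HVY : moved h V V' Y Y').
    { split; [apply HV|]; split; [apply HY|]; exists m; repeat split; auto.
      exact (et (es (moved_e HTV (et m1 (es V3)))) m2). }
    exact (et (moved_e HZV (et Z2 (es V2))) (moved_e HVY V2)). }
  intros k Y Y' W W' kh HY HW HYW.
  destruct (mediator X Y kh) as (Z & l & lh & lk & l1 & l2).
  destruct (moved_exists lh HX l1) as (Z' & HZ).
  exact (et (es (P1 k l Y Y' Z Z' kh lh lk HZ l1 l2 HY))
     (P1 k l W W' Z Z' kh lh lk HZ l1 (et l2 HYW) HW)). }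
destruct (choice P Pex) as (f & Hf).
assert (fN : forall Y, N h Y (f Y)).
{ intros Y. destruct (Hf Y) as (Z & Z' & _ & H); apply H. }
exists f; repeat split.
- apply fN.
- apply fN.
- intros k Y W H. destruct (classic (h = k)) as [<-|hk].
  + exact (et (es (N_e (fN Y))) (et H (N_e (fN W)))).
  + exact (Pk k _ _ _ _ (not_eq_sym hk) (Hf Y) (Hf W) H).
- destruct (fresh A h h h) as (k & kh & _).
  apply (A2un A (not_eq_sym kh) (fN X) HX).
  apply (Pk k X _ X); auto.
  exists X, X'; split; repeat split; auto; try apply HX; exists k; repeat split; auto.
Qed.

(** The inverse is the null map that carries [f X] back to [X], by uniqueness. *)
Lemma null_map_inv h f : null_map h f -> exists g, null_map h g /\
  (forall X, g (f X) = X) /\ (forall X, f (g X) = X).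
Proof.
intros Hf.
destruct (classic (exists X : C, True)) as [[X _]|HC].
- destruct (null_map_exists_fwd (N_sym (proj1 Hf X))) as (g & Hg & gX).
  exists g; split; auto.
  assert (comp : forall f g, null_map h f -> null_map h g -> null_map h (fun X => g (f X))).
  { intros f1 f2 H1 H2; split.
    - intros Y; exact (N_trans (proj1 H1 Y) (proj1 H2 _)).
    - intros k Y W H. now apply H2, H1. }
  assert (nid : null_map h (fun X => X)).
  { split; auto using N_refl. }
  split; intros Y.
  + apply (@null_map_unique h (fun X => g (f X)) (fun X => X) X); auto.
  + apply (@null_map_unique h (fun X => f (g X)) (fun X => X) (f X)); auto.
    now rewrite gX.
- exists (fun X => X); repeat split; auto; intros X; elim HC; eauto.
Qed.

Lemma null_map_e h f k X Y : null_map h f -> (e k (f X) (f Y) <-> e k X Y).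
Proof.
intros Hf; split; [|apply Hf].
destruct (null_map_inv Hf) as (g & Hg & gf & _).
intros H. rewrite <- (gf X), <- (gf Y). now apply Hg.
Qed.

Lemma null_map_inj h f X Y : null_map h f -> f X = f Y -> X = Y.
Proof.
intros Hf H. destruct (null_map_inv Hf) as (g & Hg & gf & _).
rewrite <- (gf X), <- (gf Y). now rewrite H.
Qed.

Lemma null_map_N h f k X Y : null_map h f -> (N k (f X) (f Y) <-> N k X Y).
Proof.
intros Hf. unfold touch. rewrite (null_map_e k X Y Hf).
split; intros [H [H1|H1]]; split; auto.
- left. eapply null_map_inj; eauto.
- right; intros j Hj; apply H1. now apply Hf.
- left. now rewrite H1.
- right; intros j Hj; apply H1. now apply (null_map_e j X Y Hf).
Qed.

(** Both sides touch each other on [h] and on [k], hence coincide. *)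
Lemma null_maps_commute_distinct h k f g X : h <> k -> null_map h f -> null_map k g ->
  f (g X) = g (f X).
Proof.
intros hk Hf Hg.
apply (N_inj (i := h) (j := k)); auto.
- apply (N_trans (N_sym (proj1 Hf _))). apply (null_map_N h X (f X) Hg), Hf.
- apply N_sym. apply (N_trans (N_sym (proj1 Hg _))). apply (null_map_N k X (g X) Hf), Hg.
Qed.

(* For [h = k], the map [f'] agrees with one of another direction on the points of a generator, since
   both commute with the maps of a third direction, which act transitively there. *)
Lemma null_maps_commute h k f g X : null_map h f -> null_map k g -> f (g X) = g (f X).
Proof.
intros Hf Hg. destruct (classic (h = k)) as [<-|hk].
2: now apply null_maps_commute_distinct with h k.
rename g into f', Hg into Hf'.
destruct (fresh A h h h) as (k & kh & _).
destruct (fresh A h k k) as (i & ih & ik & _).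
destruct (fresh A h k i) as (j & jh & jk & ji).
destruct (A2ex A X (f' X) ik) as (W & W1 & W2).
destruct (null_map_exists_fwd W1) as (s & Hs & <-).
assert (H : forall Y, e k (s Y) (f' Y)).
{ intros Y. destruct (A2ex A X Y jk) as (Z & Z1 & Z2).
  destruct (null_map_exists_fwd Z1) as (m & Hm & <-).
  apply (et (proj2 Hs _ _ _ (es Z2))).
  apply (fun H => et H (proj2 Hf' _ _ _ Z2)).
  rewrite (@null_maps_commute_distinct i j s m X); auto.
  rewrite (@null_maps_commute_distinct h j f' m X); auto.
  now apply Hm. }
apply (A2un A (i := h) (j := k) (X := X)); auto.
- exact (N_trans (proj1 Hf' _) (proj1 Hf _)).
- exact (N_trans (proj1 Hf _) (proj1 Hf' _)).
- apply (et (es (proj2 Hf _ _ _ W2))).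
  rewrite (@null_maps_commute_distinct h i f s X); auto.
Qed.

Lemma null_path X Y : exists Z i j, N i X Z /\ N j Z Y.
Proof.
destruct (classic (exists i, ~ e i X Y)) as [[i H]|H].
- destruct (Cex A H) as (Z & j & H1 & H2); eauto.
- destruct (inh A) as [i].
  destruct (fresh A i i i) as (j & ji & _), (fresh A i j j) as (k & ki & kj & _).
  exists X, i, i; split; [apply N_refl|].
  assert (X = Y) as <-; [|apply N_refl].
  apply (A1un A ji (not_eq_sym ki) (not_eq_sym kj)); apply NNPP; eauto.
Qed.

Lemma null_maps_transitive X Y : exists i j m n, null_map i m /\ null_map j n /\ n (m X) = Y.
Proof.
destruct (null_path X Y) as (Z & i & j & H1 & H2).
destruct (null_map_exists_fwd H1) as (m & Hm & <-).
destruct (null_map_exists_fwd H2) as (n & Hn & <-).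
exists i, j, m, n; auto.
Qed.

(** * Translations and the group law on circles *)

Definition translation (f : C -> C) :=
  forall h n, null_map h n -> forall X, f (n X) = n (f X).

(** Composites of null maps are transitive, so a map commuting with every null map is determined by
    one value. *)
Lemma translation_unique f g X : translation f -> translation g -> f X = g X ->
  forall Y, f Y = g Y.
Proof.
intros Hf Hg H Y.
destruct (null_maps_transitive X Y) as (i & j & m & n & Hm & Hn & <-).
rewrite (Hf j n), (Hg j n), (Hf i m), (Hg i m), H; auto.
Qed.

Lemma translation_exists X Y : exists f, translation f /\ f X = Y /\
  (forall k Z W, e k (f Z) (f W) <-> e k Z W).
Proof.
destruct (null_maps_transitive X Y) as (i & j & m & n & Hm & Hn & <-).
exists (fun Z => n (m Z)); split; [|split; auto].
- intros h p Hp Z.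
  now rewrite (null_maps_commute _ Hm Hp), (null_maps_commute _ Hn Hp).
- intros k Z W. now rewrite (null_map_e k _ _ Hn), (null_map_e k _ _ Hm).
Qed.

Lemma translations_commute f g X : translation f -> translation g -> f (g X) = g (f X).
Proof.
intros Hf Hg.
destruct (null_maps_transitive X (g X)) as (i & j & m & n & Hm & Hn & H).
assert (Hnm : translation (fun Z => n (m Z))).
{ intros h p Hp Z.
  now rewrite (null_maps_commute _ Hm Hp), (null_maps_commute _ Hn Hp). }
rewrite <- H, (Hf j n), (Hf i m); auto.
exact (translation_unique X Hnm Hg H _).
Qed.

(** A circle [X] stands for the translation [t X] that takes [O] to [X], and addition is
    composition. *)
Lemma circle_group (O : C) : exists G : abgroup C, gz G = O /\
  forall i Z X Y, e i (ga G Z X) (ga G Z Y) <-> e i X Y.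
Proof.
destruct (choice _ (translation_exists O)) as (t & Ht).
assert (t1 : forall X, translation (t X)) by (intros X; apply Ht).
assert (t2 : forall X, t X O = X) by (intros X; apply Ht).
assert (t3 : forall X, exists Y, t X Y = O).
{ intros X. destruct (translation_exists X O) as (f & Hf & fX & _).
  exists (f O). now rewrite translations_commute, t2. }
destruct (choice _ t3) as (o & Ho).
assert (tc : forall X Y, t X Y = t Y X).
{ intros X Y. rewrite <- (t2 Y) at 1. now rewrite translations_commute, t2. }
unshelve eexists.
{ refine {| gz := O; ga := t; go := o |}; auto.
  - intros X Y Z. apply (@translation_unique (fun Z => t X (t Y Z)) (t (t X Y)) O); auto.
    + intros h n Hn W. now rewrite (t1 Y h n), (t1 X h n).
    + now rewrite !t2.
  - intros X. now rewrite tc, t2. }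
split; simpl; auto. intros i Z. apply Ht.
Qed.

End Abs.

(** * The group of circles *)

Ltac splits := repeat match goal with |- _ /\ _ => split end.

Section Alg.
Variables (C I : Type) (e : I -> C -> C -> Prop).
Hypothesis A : circle_space e.
Variable G : abgroup C.
Hypothesis e_add : forall i Z X Y, e i (ga G Z X) (ga G Z Y) <-> e i X Y.

Local Notation "x + y" := (ga G x y).
Local Notation "- x" := (go G x).
Local Notation "x - y" := (ga G x (go G y)).
Local Notation "0" := (gz G).
Local Notation N := (touch e).

Definition E i x := e i 0 x.
Definition T i x := N i 0 x.

Lemma e_E i X Y : e i X Y <-> E i (Y - X).
Proof.
unfold E. rewrite <- (e_add i X 0 (Y - X)).
replace (X + 0) with X by abel G. replace (X + (Y - X)) with Y by abel G. tauto.
Qed.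

Lemma N_T i X Y : N i X Y <-> T i (Y - X).
Proof.
unfold T, touch. rewrite e_E. fold (E i (Y - X)).
split; intros [H [H1|H1]]; split; auto.
- left. rewrite H1. abel G.
- right. intros j Hj. apply H1. exact (proj2 (e_E j X Y) Hj).
- left. replace Y with (Y - X + X) by abel G. rewrite <- H1. abel G.
- right. intros j Hj. apply H1. exact (proj1 (e_E j X Y) Hj).
Qed.

Lemma E0 i : E i 0.
Proof. apply (e_refl A). Qed.

Lemma Eadd i x y : E i x -> E i y -> E i (x + y).
Proof.
intros Hx Hy. apply (e_trans A i 0 x); auto. apply (proj2 (e_E _ _ _)).
now replace (x + y - x) with y by abel G.
Qed.

Lemma Eopp i x : E i x -> E i (- x).
Proof. intros Hx. apply (e_sym A) in Hx; apply (proj1 (e_E _ _ _)) in Hx. now replace (- x) with (0 - x) by abel G. Qed.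

Lemma T0 i : T i 0.
Proof. apply (N_refl A). Qed.

Lemma Tadd i x y : T i x -> T i y -> T i (x + y).
Proof.
intros Hx Hy. apply (N_trans A Hx). apply (proj2 (N_T _ _ _)).
now replace (x + y - x) with y by abel G.
Qed.

Lemma Topp i x : T i x -> T i (- x).
Proof. intros Hx. apply (N_sym A) in Hx; apply (proj1 (N_T _ _ _)) in Hx. now replace (- x) with (0 - x) by abel G. Qed.

Lemma TE i x : T i x -> E i x.
Proof. now intros [H _]. Qed.

Hint Resolve E0 Eadd Eopp T0 Tadd Topp TE : ag.

(** Membership is proved by exhibiting a combination of known members; [abel] checks the
    identity. *)
Ltac ein x := match goal with
  | |- E ?i ?y => replace y with x by abel G; auto 12 with ag
  | |- T ?i ?y => replace y with x by abel G; auto 12 with ag end.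

Lemma sub_eq0 x y : x - y = 0 -> x = y.
Proof. intros H. replace x with (x - y + y) by abel G. rewrite H. abel G. Qed.

Lemma TE0 i j x : i <> j -> T i x -> E j x -> x = 0.
Proof. intros ij Hi Hj. symmetry. exact (N_ne Hi Hj ij). Qed.

Lemma EEE0 i j k x : i <> j -> j <> k -> i <> k -> E i x -> E j x -> E k x -> x = 0.
Proof. intros ij jk ik Hi Hj Hk. symmetry. exact (@A1un _ _ _ A i j k 0 x ij jk ik Hi Hj Hk). Qed.

(** * Decompositions along two or three generators *)

Lemma dec i j x : i <> j -> exists n m, T i n /\ E j m /\ x = n + m.
Proof.
intros ij. destruct (A2ex A 0 x ij) as (n & H1 & H2).
exists n, (x - n); split; auto. split; [exact (proj1 (e_E _ _ _) H2)|abel G].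
Qed.

Lemma T_triangle i j k n m : i <> j -> T i n -> T j m -> T k (n + m) -> n = 0 \/ m = 0.
Proof.
intros ij Hn Hm Hk.
assert (H : N j n (n + m)).
{ apply (proj2 (N_T _ _ _)). now replace (n + m - n) with m by abel G. }
destruct (no_triangle A Hn H Hk ij) as [H1|H1]; auto.
right. apply sub_eq0. replace (m - 0) with (n + m - n) by abel G. rewrite <- H1. abel G.
Qed.

Lemma T_triangle0 i j k n m : i <> j -> j <> k -> i <> k -> T i n -> T j m -> T k (n + m) ->
  n = 0 /\ m = 0.
Proof.
intros ij jk ik Hn Hm Hk.
destruct (T_triangle ij Hn Hm Hk) as [-> | ->]; split; auto.
- apply (TE0 jk Hm). apply TE. now replace m with (0 + m) by abel G.
- apply (TE0 ik Hn). apply TE. now replace n with (n + 0) by abel G.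
Qed.

Lemma C_dec i x : ~ E i x -> exists n j m, T i n /\ T j m /\ x = n + m.
Proof.
intros H. destruct (@Cex _ _ _ A i 0 x H) as (n & j & H1 & H2).
exists n, j, (x - n); split; auto. split; [exact (proj1 (N_T _ _ _) H2)|abel G].
Qed.

Lemma E_point i j k x y z : i <> j -> j <> k -> i <> k ->
  exists w, E i (w - x) /\ E j (w - y) /\ E k (w - z).
Proof.
intros ij jk ik. destruct (A1ex A x y z ij jk ik) as (w & H1 & H2 & H3).
exists w. splits; apply (proj1 (e_E _ _ _)); apply (e_sym A); auto.
Qed.

(** Axiom (S) for the closed chain of circles [0], [x], [x + y], [t]. *)
Lemma S_dec a b c d x y z t : T a x -> T b y -> T c z -> T d t ->
  x + y + z = t -> x <> 0 -> y <> 0 -> z <> 0 -> t <> 0 -> a <> c ->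
  exists o, E a o /\ E b (o - x) /\ E c (o - x - y) /\ E d o.
Proof.
intros Hx Hy Hz Ht Hs x0 y0 z0 t0 ac.
destruct (@Sax _ _ _ A a b c d 0 x (x + y) t) as (o & O1 & O2 & O3 & O4); auto.
- intros H. apply y0, sub_eq0. replace (y - 0) with (x + y - x) by abel G. rewrite <- H. abel G.
- intros H. apply z0, sub_eq0. replace (z - 0) with (x + y + z - (x + y)) by abel G.
  rewrite Hs, H. abel G.
- apply (proj2 (N_T _ _ _)). now replace (x + y - x) with y by abel G.
- apply (proj2 (N_T _ _ _)). rewrite <- Hs. now replace (x + y + z - (x + y)) with z by abel G.
- now apply (N_sym A).
- assert (sw : forall i X Y, e i X Y -> E i (X - Y)).
  { intros i X Y H. apply (proj1 (e_E _ _ _)). now apply (e_sym A). }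
  exists o; splits.
  + apply sw in O1. now replace o with (o - 0) by abel G.
  + now apply sw.
  + apply sw in O3. now replace (o - x - y) with (o - (x + y)) by abel G.
  + apply sw in O4. ein (o - t + t).
Qed.

Lemma T_dec4 j a b g x : j <> a -> j <> b -> j <> g -> a <> b -> a <> g -> b <> g ->
  T j x -> exists n m p, T a n /\ T b m /\ T g p /\ x = n + m + p.
Proof.
intros ja jb jg ab ag bg Hx.
destruct (quad_exists A ja jb jg ab ag bg Hx) as (Z & W & H1 & H2 & H3).
apply (proj1 (N_T _ _ _)) in H1, H2, H3.
exists (- (Z - x)), (- (W - Z)), (- (0 - W)); splits; auto with ag. abel G.
Qed.

(** Outside some [E i], (C) gives a sum of two null elements, each of which splits along a
    quadrangle; an element of all three of [E a], [E b], [E g] is zero. *)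
Lemma dec3 a b g x : a <> b -> a <> g -> b <> g ->
  exists n m p, T a n /\ T b m /\ T g p /\ x = n + m + p.
Proof.
intros ab ag bg.
assert (Hj : forall j y, T j y -> exists n m p, T a n /\ T b m /\ T g p /\ y = n + m + p).
{ intros j y Hy.
  destruct (classic (j = a)) as [->|ja].
  { exists y, 0, 0; splits; auto with ag. abel G. }
  destruct (classic (j = b)) as [->|jb].
  { exists 0, y, 0; splits; auto with ag. abel G. }
  destruct (classic (j = g)) as [->|jg].
  { exists 0, 0, y; splits; auto with ag. abel G. }
  apply (@T_dec4 j); auto. }
assert (Hi : forall i, ~ E i x -> exists n m p, T a n /\ T b m /\ T g p /\ x = n + m + p).
{ intros i Hx. destruct (C_dec Hx) as (y & j & z & Hy & Hz & ->).
  destruct (Hj i y Hy) as (n & m & p & n1 & m1 & p1 & ->).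
  destruct (Hj j z Hz) as (n' & m' & p' & n2 & m2 & p2 & ->).
  exists (n + n'), (m + m'), (p + p'); splits; auto with ag. abel G. }
destruct (classic (E a x)) as [Ha|Ha]; eauto.
destruct (classic (E b x)) as [Hb|Hb]; eauto.
destruct (classic (E g x)) as [Hg|Hg]; eauto.
rewrite (EEE0 ab bg ag Ha Hb Hg).
exists 0, 0, 0; splits; auto with ag. abel G.
Qed.

Lemma dec_ab a b x : a <> b -> exists n m t, T a n /\ T b m /\ E a t /\ E b t /\ x = n + m + t.
Proof.
intros ab. destruct (dec x ab) as (n & y & H1 & H2 & ->).
destruct (dec y (not_eq_sym ab)) as (m & t & H3 & H4 & ->).
exists n, m, t; splits; auto; [|abel G]. ein (m + t - m).
Qed.

Lemma dec_ab_unique a b n m t n' m' t' : a <> b -> T a n -> T b m -> E a t -> E b t ->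
  T a n' -> T b m' -> E a t' -> E b t' -> n + m + t = n' + m' + t' -> n = n' /\ m = m' /\ t = t'.
Proof.
intros ab n1 m1 t1 t2 n1' m1' t1' t2' H.
assert (Hn : n - n' = 0).
{ apply (TE0 ab); auto with ag.
  replace (n - n') with (n + m + t - n' - m - t) by abel G. rewrite H.
  ein (m' + t' - m - t). }
assert (Hm : m - m' = 0).
{ apply (TE0 (not_eq_sym ab)); auto with ag.
  replace (m - m') with (n + m + t - n - m' - t) by abel G. rewrite H.
  ein (n' + t' - n - t). }
apply sub_eq0 in Hn, Hm. splits; auto.
transitivity (n + m + t - n - m); [abel G|]. rewrite H, Hn, Hm. abel G.
Qed.

Lemma lift_exists a b g t : a <> b -> a <> g -> b <> g ->
  exists n m, T a n /\ T b m /\ T g (n + m + t).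
Proof.
intros ab ag bg. destruct (dec3 t ab ag bg) as (n & m & p & H1 & H2 & H3 & ->).
exists (- n), (- m); splits; auto with ag. ein p.
Qed.

(** * Halving elements of [U] *)

Definition half a b t d := E a t /\ E b t /\ E a d /\ E b d /\
  forall g n m, g <> a -> g <> b -> T a n -> T b m -> T g (n + m + t) -> E g (n + d).

(** A single generator [k] determines [d]; (S) shows that the same [d] serves every other [g]. *)
Lemma half_exists a b t : a <> b -> E a t -> E b t -> exists d, half a b t d.
Proof.
intros ab ta tb.
destruct (fresh A a b b) as (k & ka & kb & _).
destruct (lift_exists t ab (not_eq_sym ka) (not_eq_sym kb)) as (n & m & n1 & m1 & k1).
destruct (E_point 0 0 (- n) ab (not_eq_sym kb) (not_eq_sym ka)) as (d & d1 & d2 & d3).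
assert (da : E a d) by ein (d - 0).
assert (db : E b d) by ein (d - 0).
assert (dk : E k (n + d)) by ein (d - (- n)).
exists d; unfold half; splits; auto.
intros g n' m' ga gb n1' m1' g1.
destruct (classic (t = 0)) as [->|t0].
{ destruct (@T_triangle0 a b k n m) as [-> ->]; auto.
  { now replace (n + m) with (n + m + 0) by abel G. }
  destruct (@T_triangle0 a b g n' m') as [-> ->]; auto.
  { now replace (n' + m') with (n' + m' + 0) by abel G. }
  assert (d = 0) as ->; [|ein 0].
  apply (EEE0 (i:=a) (j:=b) (k:=k)); auto. ein (0 + d). }
destruct (classic (g = k)) as [->|gk].
{ destruct (@T_triangle0 a b k (n' - n) (m' - m)) as [H1 H2]; auto with ag.
  - ein ((n' + m' + t) - (n + m + t)).
  - apply sub_eq0 in H1. now subst. }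
assert (k0 : n + m + t <> 0).
{ intros H. apply t0. destruct (@dec_ab_unique a b n m t 0 0 0) as (_ & _ & H1); auto with ag.
  rewrite H. abel G. }
assert (g0 : n' + m' + t <> 0).
{ intros H. apply t0. destruct (@dec_ab_unique a b n' m' t 0 0 0) as (_ & _ & H1); auto with ag.
  rewrite H. abel G. }
assert (n0 : n' - n <> 0).
{ intros H. apply k0. apply (TE0 (not_eq_sym gk)); auto.
  destruct (@T_triangle0 k b g (n + m + t) (m' - m)) as [-> _]; auto with ag.
  replace (n + m + t + (m' - m)) with (n' + m' + t - (n' - n)) by abel G. rewrite H. ein (n' + m' + t). }
assert (m0 : m' - m <> 0).
{ intros H. apply k0. apply (TE0 (not_eq_sym gk)); auto.
  destruct (@T_triangle0 k a g (n + m + t) (n' - n)) as [-> _]; auto with ag.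
  replace (n + m + t + (n' - n)) with (n' + m' + t - (m' - m)) by abel G. rewrite H. ein (n' + m' + t). }
(* The two lifts of [t] to [T k] and [T g] differ by steps along [a] and [b], which closes a chain.
   The circle [o] supplied by (S) turns out to be [n' + d]. *)
destruct (@S_dec a k b g (n' - n) (n + m + t) (m' - m) (n' + m' + t)) as (o & o1 & o2 & o3 & o4);
  auto with ag.
{ abel G. }
assert (o - n' - d = 0) as Ho.
{ apply (EEE0 (i:=a) (j:=b) (k:=k)); auto with ag.
  - ein (o - (n' - n) - (n + m + t) + m + t - d).
  - ein (o - (n' - n) - (n + d)). }
apply sub_eq0 in Ho. replace (n' + d) with o; auto.
rewrite <- Ho. abel G.
Qed.

(* Modulo [T a], replacing [b] by [g] turns [d] into [t - d]; three replacements give [d = t - d]. *)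
Lemma half_switch a b g t d n r' : a <> b -> g <> a -> g <> b -> half a b t d ->
  T a n -> E g (t + n) -> half a g (t + n) r' -> exists k, T a k /\ r' = t - d + k.
Proof.
intros ab ga gb (ta & tb & da & db & H) Hn Hg (_ & _ & ra & rg & H').
destruct (lift_exists t ab (not_eq_sym ga) (not_eq_sym gb)) as (p & q & p1 & q1 & g1).
assert (H1 : E b (p - n + r')).
{ apply (H' b (p - n) (- (p + q + t))); auto with ag. ein (- q). }
specialize (H g p q ga gb p1 q1 g1).
exists (n - p); split; auto with ag. apply sub_eq0.
apply (EEE0 (i:=a) (j:=b) (k:=g)); auto 12 with ag.
- ein (p - n + r' - t + d).
- ein (r' - (t + n) + (p + d)).
Qed.

Lemma half_double a b t d : a <> b -> half a b t d -> d + d = t.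
Proof.
intros ab Hd. pose proof Hd as (ta & tb & da & db & _).
destruct (fresh A a b b) as (g & ga & gb & _).
destruct (fresh A a b g) as (h & ha & hb & hg).
destruct (dec t (not_eq_sym ga)) as (n & r & n1 & r1 & Hr).
destruct (dec r (not_eq_sym ha)) as (n2 & s & n3 & s1 & Hs).
assert (Er : r = t + - n) by (rewrite Hr; abel G).
assert (Es : s = r + - n2) by (rewrite Hs; abel G).
assert (ra : E a r) by (rewrite Er; auto with ag).
assert (sa : E a s) by (rewrite Es; auto with ag).
destruct (@half_exists a g r) as (r' & Hr'); auto.
destruct (@half_exists a h s) as (s' & Hs'); auto.
(* Modulo [T a], going from [b] to [h] by way of [g] gives [s' = d], whereas going directly gives
   [s' = t - d]. *)
destruct (@half_switch a b g t d (- n) r') as (k1 & k1' & E1); auto with ag; try now rewrite <- Er.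
destruct (@half_switch a g h r r' (- n2) s') as (k2 & k2' & E2); auto with ag; try now rewrite <- Es.
destruct (@half_switch a b h t d (- n - n2) s') as (k3 & k3' & E3); auto with ag.
{ replace (t + (- n - n2)) with s by (rewrite Es, Er; abel G); auto. }
{ replace (t + (- n - n2)) with s by (rewrite Es, Er; abel G); auto. }
apply sub_eq0. apply (TE0 ab); auto with ag.
assert (s' - s' = 0) as H by abel G.
rewrite E3 in H at 1. rewrite E2, E1, Er in H.
replace (d + d - t) with (d + d - t + 0) by abel G. rewrite <- H.
ein (k3 - k2 + k1 + n).
Qed.

(** With [t = d + d], the element [n - m] is twice [n + d] minus [n + m + t]. *)
Lemma T_diff a b g n m t : a <> b -> g <> a -> g <> b -> T a n -> T b m -> E a t -> E b t ->
  T g (n + m + t) -> E g (n - m).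
Proof.
intros ab ga gb n1 m1 ta tb g1. destruct (half_exists ab ta tb) as (d & Hd).
pose proof (half_double ab Hd) as dd. destruct Hd as (_ & _ & _ & _ & Hd).
specialize (Hd g n m ga gb n1 m1 g1). subst t. ein ((n + d) + (n + d) - (n + m + (d + d))).
Qed.

Lemma T_double a b g n m t : a <> b -> g <> a -> g <> b -> T a n -> T b m -> E a t -> E b t ->
  T g (n + m + t) -> E g (n + n + t).
Proof.
intros ab ga gb n1 m1 ta tb g1. pose proof (T_diff ab ga gb n1 m1 ta tb g1).
ein (n + m + t + (n - m)).
Qed.

Lemma no_2torsion a x : T a x -> x + x = 0 -> x = 0.
Proof.
intros Hx xx.
destruct (fresh A a a a) as (b & ba & _).
destruct (fresh A a b b) as (g & ga & gb & _).
(* If [t + t = 0], doubling the lift of [t] gives a lift of [0], whose half is [0]. So [n + n], and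
   with it [d + d = t], lies in [E g]. *)
assert (U2 : forall t, E a t -> E b t -> t + t = 0 -> t = 0).
{ intros t ta tb tt. destruct (half_exists (not_eq_sym ba) ta tb) as (d & Hd).
  pose proof (half_double (not_eq_sym ba) Hd) as dd.
  destruct Hd as (_ & _ & da & db & Hd).
  destruct (@lift_exists a b g t) as (n & m & n1 & m1 & g1); auto.
  specialize (Hd g n m ga gb n1 m1 g1).
  destruct (@half_exists a b 0) as (z & Hz); auto with ag.
  pose proof (half_double (not_eq_sym ba) Hz) as zz.
  destruct Hz as (_ & _ & za & zb & Hz).
  assert (Hz0 : z = 0).
  { apply (EEE0 (i:=a) (j:=b) (k:=g)); auto.
    replace z with (0 + z) by abel G. apply (Hz g 0 0); auto with ag. }
  subst z.
  specialize (Hz g (n + n) (m + m) ga gb).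
  assert (E g (n + n)).
  { replace (n + n) with (n + n + 0) by abel G. apply Hz; auto with ag.
    rewrite <- tt. ein (n + m + t + (n + m + t)). }
  rewrite <- dd. apply (EEE0 (i:=a) (j:=b) (k:=g)); auto with ag.
  ein (n + d + (n + d) - (n + n)). }
(* Here [x = p + m + t] with [t] killed by [U2]; what is left is a triangle of null elements. *)
destruct (dec x gb) as (p & w & p1 & w1 & Hp).
destruct (@dec_ab a b w) as (n & m & t & n1 & m1 & ta & tb & Hw); auto.
assert (n = 0) as ->.
{ apply (@TE0 a b); auto. replace n with (w - m - t) by (rewrite Hw; abel G). auto with ag. }
assert (Hpp : p + p = 0).
{ apply (@TE0 g b); auto with ag.
  replace p with (x - w) by (rewrite Hp; abel G).
  replace (x - w + (x - w)) with (x + x - w - w) by abel G. rewrite xx. auto with ag. }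
assert (ww : w + w = 0).
{ replace w with (x - p) by (rewrite Hp; abel G).
  replace (x - p + (x - p)) with (x + x - (p + p)) by abel G. rewrite xx, Hpp. abel G. }
destruct (@dec_ab_unique a b 0 (m + m) (t + t) 0 0 0) as (_ & mm & tt); auto with ag.
{ replace (0 + (m + m) + (t + t)) with ((0 + m + t) + (0 + m + t)) by abel G.
  rewrite <- Hw, ww. abel G. }
assert (t = 0) as -> by auto.
destruct (@T_triangle0 a b g x (- m)) as [H _]; auto with ag.
replace (x - m) with p by (rewrite Hp, Hw; abel G). auto.
Qed.

(** The source of the commutation rules for [al] and [be]: [T_diff] over the pairs [(a, b)] and
    [(a, g)] puts twice [p2 - q2] into [E h]. *)
Lemma swap_coordinates a b g h p1 p2 q1 q2 p1' q1' y s t : a <> b -> g <> a -> g <> b ->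
  h <> a -> h <> b -> g <> h ->
  T a p1 -> T a p2 -> T a q1 -> T a q2 -> T b y -> T b p1' -> T b q1' ->
  E a s -> E b s -> E a t -> E b t ->
  T g (p1 + y + s) -> T h (q1 + y + t) -> T g (p2 + p1' + t) -> T h (q2 + q1' + s) -> p2 = q2.
Proof.
intros ab ga gb ha hb gh Hp1 Hp2 Hq1 Hq2 Hy Hp1' Hq1' sa sb ta tb G1 H1 G2 H2.
assert (W : E g ((p2 - p1) + (p2 - p1) + (t - s))).
{ apply (@T_double a b g (p2 - p1) (p1' - y)); auto with ag.
  ein (p2 + p1' + t - (p1 + y + s)). }
(* The element of [T h] in [H1] is split anew over [a] and [g]; its part in [T g] is the element of
   [G1], and [W] places the remainder in [E g]. *)
assert (D : E h (q1 + p1 - (p2 + p2) - (p1 + y + s))).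
{ apply (@T_diff a g h _ _ ((p2 - p1) + (p2 - p1) + (t - s))); auto 10 with ag.
  ein (q1 + y + t). }
assert (D2 : E h (q1 - y)).
{ apply (@T_diff a b h q1 y t); auto. }
assert (D3 : E h (q2 + q2 + s)) by (apply (@T_double a b h q2 q1'); auto).
apply sub_eq0, (@no_2torsion a); auto with ag.
apply (@TE0 a h); auto with ag.
ein ((q1 - y) - (q1 + p1 - (p2 + p2) - (p1 + y + s)) - (q2 + q2 + s)).
Qed.

(** * Coordinates over [a] and [b], with unit generator [o] *)

Section Coordinates.
Variables (a b o : I).
Hypotheses (ab : a <> b) (oa : o <> a) (ob : o <> b).

Definition U t := E a t /\ E b t.

Lemma U0 : U 0.
Proof. split; auto with ag. Qed.

Lemma Uadd s t : U s -> U t -> U (s + t).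
Proof. intros [H1 H2] [H3 H4]; split; auto with ag. Qed.

Lemma Uopp s : U s -> U (- s).
Proof. intros [H1 H2]; split; auto with ag. Qed.

Lemma UEa t : U t -> E a t.
Proof. now intros [H _]. Qed.

Lemma UEb t : U t -> E b t.
Proof. now intros [_ H]. Qed.

Hint Resolve U0 Uadd Uopp UEa UEb : ag.

(* [U] parametrizes [T a] and [T b] through [T o]; in these coordinates [T g] consists of the
   triples [(al g t, be g t, t)]. *)
Variables (la lb : C -> C) (al be : I -> C -> C).
Hypothesis laT : forall t, U t -> T a (la t).
Hypothesis lbT : forall t, U t -> T b (lb t).
Hypothesis lo : forall t, U t -> T o (la t + lb t + t).
Hypothesis alU : forall g t, g <> a -> g <> b -> U t -> U (al g t).
Hypothesis beU : forall g t, g <> a -> g <> b -> U t -> U (be g t).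
Hypothesis lT : forall g t, g <> a -> g <> b -> U t -> T g (la (al g t) + lb (be g t) + t).

Hint Resolve laT lbT lo alU beU lT : ag.

(** Two members of [T g] with a common coordinate differ by an element of [E b], by an element of
    [E a], or by the third side of a triangle of null elements; each is zero. Coordinate identities
    thus need checking in one entry only. *)
Lemma T_coord_unique g n m t n' m' t' : g <> a -> g <> b -> T a n -> T b m -> U t ->
  T a n' -> T b m' -> U t' -> T g (n + m + t) -> T g (n' + m' + t') ->
  n = n' \/ m = m' \/ t = t' -> n = n' /\ m = m' /\ t = t'.
Proof.
intros ga gb Hn Hm [ta tb] Hn' Hm' [ta' tb'] G1 G2 H.
assert (E1 : n + m + t - (n' + m' + t') = 0).
{ destruct H as [<- | [<- | <-]].
  - apply (TE0 gb); auto with ag. ein (m + t - m' - t').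
  - apply (TE0 ga); auto with ag. ein (n + t - n' - t').
  - replace (n + m + t - (n' + m' + t)) with ((n - n') + (m - m')) by abel G.
    destruct (@T_triangle0 a b g (n - n') (m - m')) as [-> ->]; auto with ag; [|abel G].
    ein (n + m + t - (n' + m' + t)). }
apply (@dec_ab_unique a b); auto. now apply sub_eq0.
Qed.

Lemma l_inj s t : U s -> U t -> la s = la t \/ lb s = lb t -> s = t.
Proof.
intros Hs Ht H.
apply (@T_coord_unique o (la s) (lb s) s (la t) (lb t) t); auto with ag. tauto.
Qed.

Lemma la_add s t : U s -> U t -> la (s + t) = la s + la t.
Proof.
intros Hs Ht.
apply (@T_coord_unique o (la (s + t)) (lb (s + t)) (s + t) (la s + la t) (lb s + lb t) (s + t));
  auto with ag. ein (la s + lb s + s + (la t + lb t + t)).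
Qed.

Lemma lb_add s t : U s -> U t -> lb (s + t) = lb s + lb t.
Proof.
intros Hs Ht.
apply (@T_coord_unique o (la (s + t)) (lb (s + t)) (s + t) (la s + la t) (lb s + lb t) (s + t));
  auto with ag. ein (la s + lb s + s + (la t + lb t + t)).
Qed.

Lemma add_zero (f : C -> C) : (forall s t, U s -> U t -> f (s + t) = f s + f t) -> f 0 = 0.
Proof.
intros H. replace (f 0) with (f 0 + f 0 - f 0) by abel G.
rewrite <- H by auto with ag. rewrite ga_0. abel G.
Qed.

Lemma add_opp (f : C -> C) t : (forall s t, U s -> U t -> f (s + t) = f s + f t) -> U t ->
  f (- t) = - f t.
Proof.
intros H Ht. replace (f (- t)) with (f t + f (- t) - f t) by abel G.
rewrite <- H by auto with ag. rewrite ga_opp, (add_zero f H). abel G.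
Qed.

(** Splitting [x] along [o] and [b] exhibits a member of [T o] whose [T a]-part is [x]. *)
Lemma la_surj x : T a x -> exists s, U s /\ la s = x.
Proof.
intros Hx. destruct (dec x ob) as (p & w & Hp & Hw & H).
destruct (dec_ab w ab) as (n & m & t & n1 & m1 & ta & tb & Hw').
assert (n = 0) as ->.
{ apply (@TE0 a b); auto. replace n with (w - m - t) by (rewrite Hw'; abel G). auto with ag. }
assert (Ep : x + - m + - t = p) by (rewrite H, Hw'; abel G).
exists (- t); split; [split; auto with ag|].
symmetry. apply (@T_coord_unique o x (- m) (- t) (la (- t)) (lb (- t)) (- t)); auto with ag.
- split; auto with ag.
- apply laT; split; auto with ag.
- apply lbT; split; auto with ag.
- split; auto with ag.
- now rewrite Ep.
- apply lo; split; auto with ag.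
Qed.

Lemma lb_surj x : T b x -> exists s, U s /\ lb s = x.
Proof.
intros Hx. destruct (dec x oa) as (p & w & Hp & Hw & H).
destruct (dec_ab w ab) as (n & m & t & n1 & m1 & ta & tb & Hw').
assert (m = 0) as ->.
{ apply (@TE0 b a); auto. replace m with (w - n - t) by (rewrite Hw'; abel G). auto with ag. }
assert (Ep : - n + x + - t = p) by (rewrite H, Hw'; abel G).
exists (- t); split; [split; auto with ag|].
symmetry. apply (@T_coord_unique o (- n) x (- t) (la (- t)) (lb (- t)) (- t)); auto with ag.
- split; auto with ag.
- apply laT; split; auto with ag.
- apply lbT; split; auto with ag.
- split; auto with ag.
- now rewrite Ep.
- apply lo; split; auto with ag.
Qed.

Lemma coordinates x : exists s r t, U s /\ U r /\ U t /\ x = la s + lb r + t.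
Proof.
destruct (dec_ab x ab) as (n & m & t & n1 & m1 & ta & tb & ->).
destruct (la_surj n1) as (s & Hs & <-), (lb_surj m1) as (r & Hr & <-).
exists s, r, t; splits; auto. split; auto.
Qed.

Lemma coordinates_unique s r t s' r' t' : U s -> U r -> U t -> U s' -> U r' -> U t' ->
  la s + lb r + t = la s' + lb r' + t' -> s = s' /\ r = r' /\ t = t'.
Proof.
intros Hs Hr Ht Hs' Hr' Ht' H.
apply dec_ab_unique with (a := a) (b := b) in H; auto with ag.
destruct H as (H1 & H2 & H3); splits; auto using l_inj.
Qed.

Lemma T_coord g x : g <> a -> g <> b -> T g x ->
  exists t, U t /\ x = la (al g t) + lb (be g t) + t.
Proof.
intros ga gb Hx. destruct (coordinates x) as (s & r & t & Hs & Hr & Ht & ->).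
exists t; split; auto.
destruct (@T_coord_unique g (la s) (lb r) t (la (al g t)) (lb (be g t)) t) as (H1 & H2 & _);
  auto with ag.
now rewrite H1, H2.
Qed.

Lemma al_o t : U t -> al o t = t.
Proof.
intros Ht. apply l_inj; auto with ag. left.
apply (@T_coord_unique o (la (al o t)) (lb (be o t)) t (la t) (lb t) t); auto with ag.
Qed.

Lemma be_o t : U t -> be o t = t.
Proof.
intros Ht. apply l_inj; auto with ag. right.
apply (@T_coord_unique o (la (al o t)) (lb (be o t)) t (la t) (lb t) t); auto with ag.
Qed.

Lemma albe_inj g s t : g <> a -> g <> b -> U s -> U t -> al g s = al g t \/ be g s = be g t -> s = t.
Proof.
intros ga gb Hs Ht H.
apply (@T_coord_unique g (la (al g s)) (lb (be g s)) s (la (al g t)) (lb (be g t)) t); auto with ag.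
destruct H as [-> | ->]; auto.
Qed.

Lemma albe_add g s t : g <> a -> g <> b -> U s -> U t ->
  al g (s + t) = al g s + al g t /\ be g (s + t) = be g s + be g t.
Proof.
intros ga gb Hs Ht.
destruct (@T_coord_unique g (la (al g (s + t))) (lb (be g (s + t))) (s + t)
  (la (al g s + al g t)) (lb (be g s + be g t)) (s + t)) as (H1 & H2 & _); auto with ag.
- rewrite la_add, lb_add by auto with ag.
  ein (la (al g s) + lb (be g s) + s + (la (al g t) + lb (be g t) + t)).
- split; apply l_inj; auto with ag.
Qed.

Lemma al_add g : g <> a -> g <> b -> forall s t, U s -> U t -> al g (s + t) = al g s + al g t.
Proof. intros. now apply albe_add. Qed.

Lemma be_add g : g <> a -> g <> b -> forall s t, U s -> U t -> be g (s + t) = be g s + be g t.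
Proof. intros. now apply albe_add. Qed.

Lemma be_al_swap g h s t : g <> a -> g <> b -> h <> a -> h <> b -> U s -> U t ->
  be g s = be h t -> al g t = al h s.
Proof.
intros ga gb ha hb Hs Ht H. destruct (classic (g = h)) as [<- | gh].
{ f_equal. symmetry. apply (@albe_inj g); auto. }
apply l_inj; auto with ag. left.
apply (@swap_coordinates a b g h (la (al g s)) (la (al g t)) (la (al h t)) (la (al h s))
  (lb (be g t)) (lb (be h s)) (lb (be g s)) s t); auto with ag.
rewrite H; auto with ag.
Qed.

(** The swap rule against the unit [o], whose operators are the identity. *)
Lemma al_be g t : g <> a -> g <> b -> U t -> al g (be g t) = t.
Proof.
intros ga gb Ht. rewrite (@be_al_swap g o t (be g t)); auto using al_o with ag.
symmetry. auto using be_o with ag.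
Qed.

Lemma be_al g t : g <> a -> g <> b -> U t -> be g (al g t) = t.
Proof.
intros ga gb Ht. apply (@albe_inj g); auto with ag. left. auto using al_be with ag.
Qed.

Lemma al_comm g h t : g <> a -> g <> b -> h <> a -> h <> b -> U t ->
  al g (al h t) = al h (al g t).
Proof.
intros ga gb ha hb Ht. apply be_al_swap; auto with ag. now rewrite !be_al.
Qed.

(** From [la s + t], (C) splits off a summand in [T b] and leaves a member of some [T k] with
    coordinates [la s] and [t]; this [k] is the wanted generator. *)
Lemma al_transitive s t : U s -> U t -> s <> 0 -> t <> 0 ->
  exists g, g <> a /\ g <> b /\ al g t = s.
Proof.
intros Hs Ht s0 t0.
assert (Hx : ~ E b (la s + t)).
{ intros H. apply s0, l_inj; auto with ag. left. rewrite (add_zero la la_add).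
  apply (TE0 ab); auto with ag. ein (la s + t - t). }
destruct (C_dec Hx) as (n & k & m & Hn & Hm & H).
assert (kb : k <> b).
{ intros ->. apply Hx. rewrite H. auto with ag. }
assert (ka : k <> a).
{ intros ->. apply t0. destruct (@dec_ab_unique a b (la s) 0 t m n 0) as (_ & _ & H1);
  auto with ag. replace (la s + 0 + t) with (la s + t) by abel G. rewrite H. abel G. }
destruct (T_coord ka kb Hm) as (r & Hr & ->).
exists k; splits; auto.
destruct (@dec_ab_unique a b (la s) 0 t (la (al k r)) (n + lb (be k r)) r) as (H1 & _ & ->);
  auto with ag.
- replace (la s + 0 + t) with (la s + t) by abel G. rewrite H. abel G.
- apply l_inj; auto with ag.
Qed.

(** * Operators on [U] that commute with every [al k] *)

Definition op f := (forall t, U t -> U (f t)) /\ f 0 = 0 /\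
  forall k t, k <> a -> k <> b -> U t -> f (al k t) = al k (f t).

(** A Schur-type argument: transitivity of the [al k] carries agreement at one nonzero point to all
    others. *)
Lemma op_rigid f g t0 : op f -> op g -> U t0 -> t0 <> 0 -> f t0 = g t0 ->
  forall t, U t -> f t = g t.
Proof.
intros (fU & f0 & fa) (gU & g0 & ga) Ht0 nt0 H t Ht.
destruct (classic (t = 0)) as [-> | nt]; [now rewrite f0, g0|].
destruct (al_transitive Ht Ht0 nt nt0) as (k & ka & kb & <-).
rewrite fa, ga, H; auto.
Qed.

Lemma op_al k : k <> a -> k <> b -> op (al k).
Proof.
intros ka kb; unfold op; splits; auto using al_comm.
apply add_zero, al_add; auto.
Qed.

Lemma op_be_comm f k t : op f -> k <> a -> k <> b -> U t -> f (be k t) = be k (f t).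
Proof.
intros (fU & f0 & fa) ka kb Ht. apply (@albe_inj k); auto with ag. left.
rewrite <- fa, !al_be; auto with ag.
Qed.

Lemma op_be k : k <> a -> k <> b -> op (be k).
Proof.
intros ka kb; unfold op; splits; auto.
- apply add_zero, be_add; auto.
- intros j t ja jb Ht. symmetry. apply op_be_comm; auto. now apply op_al.
Qed.

Lemma op_comp f g : op f -> op g -> op (fun t => f (g t)).
Proof.
intros (fU & f0 & fa) (gU & g0 & ga); unfold op; splits; auto.
- now rewrite g0.
- intros k t ka kb Ht. rewrite ga, fa; auto.
Qed.

Lemma op_al_ex f t0 : op f -> U t0 -> t0 <> 0 -> f t0 <> 0 ->
  exists k, k <> a /\ k <> b /\ forall t, U t -> al k t = f t.
Proof.
intros Hf Ht0 n0 nf. destruct (@al_transitive (f t0) t0) as (k & ka & kb & H); auto.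
{ now apply Hf. }
exists k; splits; auto. apply (op_rigid (t0 := t0)); auto using op_al.
Qed.

(** Otherwise [T g] and [T h] would share a nonzero element, since the [be] parts agree as well. *)
Lemma al_index g h t : g <> a -> g <> b -> h <> a -> h <> b -> U t -> t <> 0 ->
  al g t = al h t -> g = h.
Proof.
intros ga gb ha hb Ht t0 H.
assert (Hb : be g t = be h t).
{ apply (@albe_inj g); auto with ag. left.
  rewrite al_be, (op_rigid (op_al ga gb) (op_al ha hb) Ht t0 H), al_be; auto with ag. }
apply NNPP; intro gh. apply t0.
destruct (@dec_ab_unique a b (la (al g t)) (lb (be g t)) t 0 0 0) as (_ & _ & H1); auto with ag.
transitivity 0; [|abel G]. apply (TE0 gh); auto with ag. rewrite H, Hb. auto with ag.
Qed.

(** * The reflection in coordinates *)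

Variables (p q : C).
Hypotheses (Hp : U p) (Hq : U q) (p0 : p <> 0) (q0 : q <> 0).

Lemma opp_neq0 t : t <> 0 -> - t <> 0.
Proof. intros H H1; apply H. replace t with (- (- t)) by abel G. rewrite H1. abel G. Qed.

(** [phi] is the linear part, and [v] stands for [L] when [K] is the origin. The difference
    [phi x + v - x] is the displacement of [x] under the affine reflection. *)
Lemma coordinate_reflection : exists (phi : C -> C) (tau : I -> I),
  let v := la p + lb q in
  (forall x y, phi (x + y) = phi x + phi y) /\ (forall x, phi (phi x) = x) /\
  (forall i, tau (tau i) = i) /\ (forall i x, T i x -> T (tau i) (phi x)) /\
  phi v = - v /\ (forall i, E i v -> tau i = i) /\
  (forall i n j m, T i n -> T j m -> v = n + m -> i <> j -> tau i = j) /\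
  (forall i x, tau i <> i -> E (tau i) (phi x + v - x) -> phi x + v = x) /\
  (forall i x, tau i = i -> E i (phi x + v - x)).
Proof.
(* This choice makes [c] map [q] to [- p], which yields [phi v = - v]. *)
destruct (@al_transitive p (- q)) as (m & ma & mb & Hm); auto using opp_neq0 with ag.
set (c := al m). set (c' := be m).
assert (cop : op c) by now apply op_al.
assert (cop' : op c') by now apply op_be.
assert (cU : forall t, U t -> U (c t)) by apply cop.
assert (cU' : forall t, U t -> U (c' t)) by apply cop'.
assert (cc' : forall t, U t -> c (c' t) = t) by (intros; now apply al_be).
assert (c'c : forall t, U t -> c' (c t) = t) by (intros; now apply be_al).
assert (cadd : forall s t, U s -> U t -> c (s + t) = c s + c t) by now apply al_add.
assert (cadd' : forall s t, U s -> U t -> c' (s + t) = c' s + c' t) by now apply be_add.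
assert (cq : c q = - p).
{ replace q with (- (- q)) by abel G. rewrite add_opp; auto with ag. fold c in Hm. now rewrite Hm. }
assert (cp : c' p = - q).
{ rewrite <- (c'c (- q)) by auto with ag. f_equal. symmetry. exact Hm. }
assert (Hphi : forall x, exists y, exists s r t, U s /\ U r /\ U t /\ x = la s + lb r + t /\
   y = la (c r) + lb (c' s) + t).
{ intros x. destruct (coordinates x) as (s & r & t & Hs & Hr & Ht & H).
  exists (la (c r) + lb (c' s) + t), s, r, t; splits; auto. }
destruct (choice _ Hphi) as (phi & Hphi'); clear Hphi.
assert (Hphi : forall s r t, U s -> U r -> U t ->
  phi (la s + lb r + t) = la (c r) + lb (c' s) + t).
{ intros s r t Hs Hr Ht.
  destruct (Hphi' (la s + lb r + t)) as (s' & r' & t' & Hs' & Hr' & Ht' & H & ->).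
  destruct (coordinates_unique Hs Hr Ht Hs' Hr' Ht' H) as (-> & -> & ->); auto. }
clear Hphi'.
assert (Htau : forall k, exists k', (k = a -> k' = b) /\ (k = b -> k' = a) /\
  (k <> a -> k <> b -> k' <> a /\ k' <> b /\ forall t, U t -> al k' t = c (be k t))).
{ intros k. destruct (classic (k = a)) as [-> | ka].
  { exists b; splits; tauto. }
  destruct (classic (k = b)) as [-> | kb].
  { exists a; splits; tauto. }
  destruct (@op_al_ex (fun t => c (be k t)) p) as (k' & k'a & k'b & H); auto.
  - apply op_comp; auto using op_be.
  - intros H. apply p0. rewrite <- (@al_be k p), <- (c'c (be k p)), H by auto with ag.
    rewrite (proj1 (proj2 cop')). now apply (op_al ka kb).
  - exists k'; splits; tauto. }
destruct (choice _ Htau) as (tau & Htau'); clear Htau.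
assert (ta : tau a = b) by now apply Htau'.
assert (tb : tau b = a) by now apply Htau'.
assert (tU : forall k, k <> a -> k <> b -> tau k <> a /\ tau k <> b).
{ intros k ka kb. destruct (Htau' k) as (_ & _ & H). destruct (H ka kb) as (H1 & H2 & _); auto. }
assert (tal : forall k t, k <> a -> k <> b -> U t -> al (tau k) t = c (be k t)).
{ intros k t ka kb Ht. destruct (Htau' k) as (_ & _ & H). now apply H. }
clear Htau'.
assert (tinv : forall k, tau (tau k) = k).
{ intros k. destruct (classic (k = a)) as [-> | ka]; [congruence|].
  destruct (classic (k = b)) as [-> | kb]; [congruence|].
  destruct (tU k ka kb) as [k1 k2]. destruct (tU _ k1 k2) as [k3 k4].
  apply (@al_index _ _ p); auto. rewrite tal by auto.
  transitivity (al k (c (be k (be (tau k) p)))).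
  - rewrite (@op_be_comm c k), al_be; auto with ag.
  - f_equal. rewrite <- tal, al_be; auto with ag. }
exists phi, tau.
set (v := la p + lb q); cbv zeta.
(* All displacements lie in one family parametrized by [r], so the last clauses reduce to its
   members. *)
assert (Hv : forall x, exists r, U r /\ phi x + v - x = la r - lb (c' r)).
{ intros x. destruct (coordinates x) as (s & r & t & Hs & Hr & Ht & ->).
  exists (c r - s + p); split; [auto with ag|].
  rewrite Hphi by auto.
  rewrite !cadd', (add_opp c'), c'c, cp, !la_add, (add_opp la), !lb_add, !(add_opp lb) by auto using la_add, lb_add with ag.
  unfold v. abel G. }
assert (Hfix : forall k r, U r -> r <> 0 -> E k (la r - lb (c' r)) -> tau k = k).
{ intros k r Hr r0 Hk.
  assert (zero : forall l, l <> b -> E l (lb (c' r)) -> False).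
  { intros l Hl H. apply r0. rewrite <- (cc' r) by auto.
    replace (c' r) with 0; [apply cop|]. symmetry.
    apply l_inj; auto with ag. right. rewrite (add_zero lb lb_add).
    apply (@TE0 b l); auto with ag. }
  destruct (classic (k = a)) as [-> | ka].
  { exfalso. apply (zero a); auto. ein (la r - (la r - lb (c' r))). }
  destruct (classic (k = b)) as [-> | kb].
  { exfalso. apply r0, l_inj; auto with ag. left. rewrite (add_zero la la_add).
    apply (TE0 ab); auto with ag. ein (la r - lb (c' r) + lb (c' r)). }
  destruct (tU k ka kb) as [k1 k2].
  apply (@al_index _ _ (be k r)); auto with ag.
  { intros H. apply r0. rewrite <- (@al_be k r), H by auto. now apply op_al. }
  rewrite tal, al_be by auto with ag.
  rewrite <- (cc' r) at 2 by auto. f_equal.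
  apply l_inj; auto with ag. right. apply sub_eq0, (@TE0 b k); auto with ag.
  (* [T_diff] gives a second such difference in [E k], with [be k] squared in place of [c']. Hence
     both agree at [r]. *)
  assert (H : E k (la (al k (be k r)) - lb (be k (be k r)))).
  { apply (@T_diff a b k _ _ (be k r)); auto with ag. }
  rewrite al_be in H by auto.
  ein (la r - lb (c' r) - (la r - lb (be k (be k r)))). }
assert (Ev : v = la p - lb (c' p)).
{ unfold v. rewrite cp, (add_opp lb) by auto using lb_add. abel G. }
splits.
- intros x y. destruct (coordinates x) as (s & r & t & Hs & Hr & Ht & ->).
  destruct (coordinates y) as (s1 & r1 & t1 & Hs1 & Hr1 & Ht1 & ->).
  replace (la s + lb r + t + (la s1 + lb r1 + t1)) with (la (s + s1) + lb (r + r1) + (t + t1)).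
  + rewrite !Hphi, cadd, cadd', la_add, lb_add by auto with ag. abel G.
  + rewrite la_add, lb_add by auto. abel G.
- intros x. destruct (coordinates x) as (s & r & t & Hs & Hr & Ht & ->).
  rewrite !Hphi, cc', c'c; auto with ag.
- exact tinv.
- intros k x Hx. destruct (classic (k = a)) as [-> | ka].
  { destruct (la_surj Hx) as (s & Hs & <-). rewrite ta.
    replace (la s) with (la s + lb 0 + 0) by (rewrite (add_zero lb lb_add); abel G).
    rewrite Hphi, (proj1 (proj2 cop)), (add_zero la la_add) by auto with ag. ein (lb (c' s)). }
  destruct (classic (k = b)) as [-> | kb].
  { destruct (lb_surj Hx) as (s & Hs & <-). rewrite tb.
    replace (lb s) with (la 0 + lb s + 0) by (rewrite (add_zero la la_add); abel G).
    rewrite Hphi, (proj1 (proj2 cop')), (add_zero lb lb_add) by auto with ag. ein (la (c s)). }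
  destruct (T_coord ka kb Hx) as (t & Ht & ->). destruct (tU k ka kb) as [k1 k2].
  rewrite Hphi by auto with ag. rewrite <- tal by auto.
  replace (c' (al k t)) with (be (tau k) t); auto with ag.
  apply (@albe_inj (tau k)); auto with ag. left.
  rewrite al_be, tal, <- (op_be_comm cop'), cc', be_al; auto with ag.
- unfold v. replace (la p + lb q) with (la p + lb q + 0) at 1 by abel G.
  rewrite Hphi, cq, cp, (add_opp la), (add_opp lb) by auto using la_add, lb_add with ag. abel G.
- intros k Hk. apply (Hfix k p); auto. now rewrite <- Ev.
- intros i n j m' Hn Hm' H ij. unfold v in H.
  (* If one summand lies along [a] or [b], the other lies along the opposite one; anything else
     makes a triangle of null elements. *)
  assert (tri : forall k x, k <> a -> k <> b -> T k (la p + lb q - x) -> T a x \/ T b x -> False).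
  { intros k x ka kb Hx [H1 | H1].
    - destruct (@T_triangle0 a b k (la p - x) (lb q)) as [_ H2]; auto with ag.
      + ein (la p + lb q - x).
      + apply q0, l_inj; auto with ag. right. now rewrite (add_zero lb lb_add).
    - destruct (@T_triangle0 a b k (la p) (lb q - x)) as [H2 _]; auto with ag.
      + ein (la p + lb q - x).
      + apply p0, l_inj; auto with ag. left. now rewrite (add_zero la la_add). }
  assert (En : n = la p + lb q - m') by (rewrite H; abel G).
  assert (Em : m' = la p + lb q - n) by (rewrite H; abel G).
  destruct (classic (i = a)) as [-> | ia].
  { rewrite ta. apply NNPP; intro jb. rewrite Em in Hm'. apply (tri j n); auto. }
  destruct (classic (i = b)) as [-> | ib].
  { rewrite tb. apply NNPP; intro ja. rewrite Em in Hm'. apply (tri j n); auto. }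
  destruct (classic (j = a)) as [-> | ja].
  { exfalso. rewrite En in Hn. apply (tri i m'); auto. }
  destruct (classic (j = b)) as [-> | jb].
  { exfalso. rewrite En in Hn. apply (tri i m'); auto. }
  destruct (T_coord ia ib Hn) as (t & Ht & E1). destruct (T_coord ja jb Hm') as (t' & Ht' & E2).
  destruct (@coordinates_unique p q 0 (al i t + al j t') (be i t + be j t') (t + t'))
    as (H1 & H2 & H3); auto with ag.
  { rewrite la_add, lb_add by auto with ag.
    replace (la p + lb q + 0) with (la p + lb q) by abel G. rewrite H, E1, E2. abel G. }
  assert (t' = - t) as ->.
  { replace t' with (t + t' - t) by abel G. rewrite <- H3. abel G. }
  rewrite (add_opp (al j)) in H1 by auto using al_add.
  rewrite (add_opp (be j)) in H2 by auto using be_add.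
  destruct (tU i ia ib) as [i1 i2].
  (* Comparing coordinates, [al i (al j q) = - p = c q], so [c] is the composite of [al i] and
     [al j], and [tau i] has the operator [al j]. *)
  apply (@al_index _ _ p); auto. rewrite tal by auto.
  rewrite (@op_rigid c (fun x => al i (al j x)) q); auto with ag.
  + rewrite al_comm, al_be; auto with ag.
  + apply op_comp; auto using op_al.
  + rewrite cq, H1, H2, al_add, (add_opp (al j)), al_be, al_add, (add_opp (al i)),
      (@al_comm i j), al_be by auto using al_add with ag. abel G.
- intros i x Hi Hx. destruct (Hv x) as (r & Hr & H). rewrite H in Hx.
  destruct (classic (r = 0)) as [-> | r0].
  + apply sub_eq0. rewrite H, (proj1 (proj2 cop')), (add_zero la la_add), (add_zero lb lb_add).
    abel G.
  + elim Hi. rewrite <- (tinv i) at 2. symmetry. now apply Hfix with r.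
- intros i x Hi. destruct (Hv x) as (r & Hr & ->).
  assert (ia : i <> a) by (intros ->; congruence).
  assert (ib : i <> b) by (intros ->; congruence).
  assert (Hb : be i (be i r) = c' r).
  { rewrite <- (c'c (be i (be i r))) by auto with ag. f_equal.
    rewrite <- tal, Hi, al_be; auto with ag. }
  assert (H : E i (la (al i (be i r)) - lb (be i (be i r)))).
  { apply (@T_diff a b i _ _ (be i r)); auto with ag. }
  now rewrite Hb, al_be in H by auto.
Qed.

End Coordinates.

(** As [v] is in no [T i], (C) writes it as a sum of nonzero null elements along distinct generators
    [a] and [b], which serve as the frame. *)
Lemma reflection v : (forall i, ~ T i v) -> exists (phi : C -> C) (tau : I -> I),
  (forall x y, phi (x + y) = phi x + phi y) /\ (forall x, phi (phi x) = x) /\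
  (forall i, tau (tau i) = i) /\ (forall i x, T i x -> T (tau i) (phi x)) /\
  phi v = - v /\ (forall i, E i v -> tau i = i) /\
  (forall i n j m, T i n -> T j m -> v = n + m -> i <> j -> tau i = j) /\
  (forall i x, tau i <> i -> E (tau i) (phi x + v - x) -> phi x + v = x) /\
  (forall i x, tau i = i -> E i (phi x + v - x)).
Proof.
intros Hv.
assert (exists a, ~ E a v) as [a Ha].
{ apply NNPP; intros H. destruct (inh A) as [i].
  destruct (fresh A i i i) as (j & ji & _), (fresh A i j j) as (k & ki & kj & _).
  apply (Hv i). rewrite (@EEE0 i j k v); auto with ag; apply NNPP; eauto. }
destruct (C_dec Ha) as (n & b & m & Hn & Hm & ->).
assert (ab : a <> b) by (intros ->; apply (Hv b); auto with ag).
assert (n0 : n <> 0).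
{ intros ->. apply (Hv b). now rewrite ga_0. }
assert (m0 : m <> 0).
{ intros ->. apply (Hv a). now rewrite ga_0r. }
destruct (fresh A a b b) as (o & oa & ob & _).
(* The pairs [(0, 0)] are fillers for the generators [a] and [b], which have no coordinates. *)
assert (HL : forall gt : I * C, exists nm : C * C, fst gt <> a -> fst gt <> b ->
  T a (fst nm) /\ T b (snd nm) /\ T (fst gt) (fst nm + snd nm + snd gt)).
{ intros [g t]. destruct (classic (g = a)) as [-> | ga].
  { exists (0, 0). now intros []. }
  destruct (classic (g = b)) as [-> | gb].
  { exists (0, 0). now intros _ []. }
  destruct (@lift_exists a b g t) as (x & y & H); auto. exists (x, y); auto. }
destruct (choice _ HL) as (l & Hl); clear HL.
set (la t := fst (l (o, t))). set (lb t := snd (l (o, t))).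
assert (Ho : forall t, T a (la t) /\ T b (lb t) /\ T o (la t + lb t + t)).
{ intros t. now apply (Hl (o, t)). }
assert (laT : forall t, U a b t -> T a (la t)) by (intros; apply Ho).
assert (lbT : forall t, U a b t -> T b (lb t)) by (intros; apply Ho).
assert (loT : forall t, U a b t -> T o (la t + lb t + t)) by (intros; apply Ho).
assert (la_s : forall x, T a x -> exists s, U a b s /\ la s = x) by (apply (@la_surj a b o ab oa ob la lb); auto).
assert (lb_s : forall x, T b x -> exists s, U a b s /\ lb s = x) by (apply (@lb_surj a b o ab oa ob la lb); auto).
assert (Hal : forall gt : I * C, exists pq : C * C, fst gt <> a -> fst gt <> b ->
  U a b (fst pq) /\ la (fst pq) = fst (l gt) /\ U a b (snd pq) /\ lb (snd pq) = snd (l gt)).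
{ intros gt. destruct (classic (fst gt <> a /\ fst gt <> b)) as [[ga gb]|H].
  2: { exists (0, 0); tauto. }
  destruct (Hl gt ga gb) as (H1 & H2 & _).
  destruct (la_s _ H1) as (s & Hs), (lb_s _ H2) as (r & Hr). exists (s, r); simpl; tauto. }
destruct (choice _ Hal) as (ab' & Hab); clear Hal.
destruct (la_s _ Hn) as (p & Hp & <-), (lb_s _ Hm) as (q & Hq & <-).
apply (@coordinate_reflection a b o ab oa ob la lb
  (fun g t => fst (ab' (g, t))) (fun g t => snd (ab' (g, t)))); auto.
- intros g t ga gb _. now apply (Hab (g, t)).
- intros g t ga gb _. now apply (Hab (g, t)).
- intros g t ga gb _. destruct (Hab (g, t) ga gb) as (_ & -> & _ & ->).
  now apply (Hl (g, t)).
- intros ->. apply n0. apply (@add_zero a b la), (@la_add a b o ab oa ob la lb); auto.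
- intros ->. apply m0. apply (@add_zero a b lb), (@lb_add a b o ab oa ob la lb); auto.
Qed.

End Alg.

(** With [K] as origin the map is [X |-> phi X + L]. It preserves contact because [phi] permutes the
    [T i], and meeting because [e] is definable from contact. *)
Theorem circle_reflection (C I : Type) (e : I -> C -> C -> Prop) (K L : C) :
  circle_space e -> (forall i, ~ touch e i K L) ->
  exists (phi : C -> C) (tau : I -> I),
  (forall X, phi (phi X) = X) /\ (forall i, tau (tau i) = i) /\
  (forall i X Y, e i X Y -> e (tau i) (phi X) (phi Y)) /\ phi K = L /\
  (forall i, e i K L -> tau i = i) /\
  (forall i j M, touch e i K M -> touch e j M L -> i <> j -> tau i = j) /\
  (forall i M, tau i <> i -> e (tau i) M (phi M) -> phi M = M) /\
  (forall i M, tau i = i -> e i M (phi M)).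
Proof.
intros A HKL. destruct (circle_group A K) as (G & <- & HG).
destruct (@reflection C I e A G HG L HKL) as (phi & tau & H1 & H2 & H3 & H4 & H5 & H6 & H7 & H8 & H9).
set (f X := ga G (phi X) L).
assert (f0 : f (gz G) = L).
{ unfold f. replace (phi (gz G)) with (gz G); [apply ga_0|].
  apply (@ga_cancel _ G _ _ (phi (gz G))). now rewrite <- H1, !ga_0. }
assert (ff : forall X, f (f X) = X).
{ intros X. unfold f. rewrite H1, H2, H5. abel G. }
assert (fopp : forall X, phi (go G X) = go G (phi X)).
{ intros X. apply (@ga_cancel _ G _ _ (phi X)). rewrite <- H1.
  replace (ga G (go G X) X) with (gz G) by abel G.
  replace (ga G (go G (phi X)) (phi X)) with (gz G) by abel G.
  apply (@ga_cancel _ G _ _ (phi (gz G))). now rewrite <- H1, !ga_0. }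
assert (fN : forall i X Y, touch e i X Y -> touch e (tau i) (f X) (f Y)).
{ intros i X Y H. apply (N_T e G HG). apply (N_T e G HG), H4 in H. unfold f.
  replace (ga G (ga G (phi Y) L) (go G (ga G (phi X) L))) with (phi (ga G Y (go G X))); auto.
  rewrite H1, fopp. abel G. }
exists f, tau; splits; auto.
- intros i X Y. rewrite (e_from_N A i X Y), (e_from_N A (tau i) (f X) (f Y)).
  intros [H|H]; [left; auto|right]. intros (W & j & ji & WY & W1 & W2). apply H.
  apply fN in W1, W2. rewrite H3, !ff in W1. rewrite ff in W2.
  exists (f W), (tau j); splits; auto; intros E; [apply ji|apply WY]; congruence.
- intros i j M HM HL ij. apply (H7 i M j (ga G L (go G M))); auto; [|abel G].
  exact (proj1 (N_T e G HG _ _ _) HL).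
- intros i M Hi H. apply (H8 i); auto. exact (proj1 (e_E e G HG _ _ _) H).
- intros i M Hi. apply (proj2 (e_E e G HG _ _ _)). now apply H9.
Qed.

(** * From circles back to points *)

Section Plane.
Variables (P C : Type) (par : P -> P -> Prop) (inc : P -> C -> Prop).
Hypotheses (LP : laguerre_plane par inc) (HC : axiom_C inc) (HS : axiom_S par inc).
Variable foot : P -> C -> P.
Hypothesis foot_spec : forall p K, inc (foot p K) K /\ par (foot p K) p.
Variable K0 : C.

Let pr := lp_par_refl LP.
Let ps := lp_par_sym LP.
Let pt := lp_par_trans LP.

(** Each generator is represented by its point on the fixed circle [K0]. *)
Definition gen := {p : P | inc p K0}.
Definition at_gen (i : gen) (K : C) : P := foot (proj1_sig i) K.
Definition gen_of (p : P) : gen := exist _ (foot p K0) (proj1 (foot_spec p K0)).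
Definition agree (i : gen) (K L : C) : Prop := at_gen i K = at_gen i L.

Lemma foot_unique p q K : inc q K -> par q p -> q = foot p K.
Proof.
intros H1 H2. destruct (lp_ax3 LP p K) as (r & _ & Hr).
rewrite <- (Hr q), <- (Hr (foot p K)); auto.
Qed.

Lemma at_gen_inc i K : inc (at_gen i K) K.
Proof. apply foot_spec. Qed.

Lemma gen_eq (i j : gen) : par (proj1_sig i) (proj1_sig j) -> i = j.
Proof.
destruct i as [x Hx], j as [y Hy]; simpl; intros H.
assert (x = y) as <-.
{ rewrite (foot_unique Hx H). symmetry. now apply foot_unique. }
f_equal. apply proof_irrelevance.
Qed.

Lemma par_at_gen i j K L : par (at_gen i K) (at_gen j L) -> i = j.
Proof.
intros H. apply gen_eq. apply (pt (ps (proj2 (foot_spec (proj1_sig i) K)))).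
exact (pt H (proj2 (foot_spec (proj1_sig j) L))).
Qed.

Lemma at_gen_of p K : inc p K -> at_gen (gen_of p) K = p.
Proof.
intros H. symmetry. apply foot_unique; auto. simpl. apply ps, foot_spec.
Qed.

Lemma agree_inc i K L : agree i K L <-> inc (at_gen i K) L.
Proof.
split.
- intros ->. apply at_gen_inc.
- intros H. apply foot_unique; auto. apply foot_spec.
Qed.

Lemma N_tangent i K L : touch agree i K L <-> tangent_at inc (at_gen i K) K L.
Proof.
split.
- intros [H [->|H1]]; [right; split; auto; apply at_gen_inc|left].
  intros z; split.
  + intros [zK zL]. rewrite <- (at_gen_of zK). f_equal. apply H1.
    unfold agree. now rewrite !at_gen_of.
  + intros ->. split; [apply at_gen_inc|now apply agree_inc].
- intros [H|[<- _]].
  + split.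
    * apply agree_inc. now apply (H (at_gen i K)).
    * right. intros j Hj. apply (@par_at_gen j i K K).
      replace (at_gen j K) with (at_gen i K); auto. symmetry. apply H.
      split; [apply at_gen_inc|now apply agree_inc].
  + split; [reflexivity|now left].
Qed.

Lemma N_single i K L : touch agree i K L -> K <> L -> meet_single inc K L (at_gen i K).
Proof. intros H H1. apply N_tangent in H as [H|[H _]]; auto. now elim H1. Qed.

Lemma agree_A2ex i j X Y : i <> j -> exists W, touch agree i X W /\ agree j W Y.
Proof.
intros ij. destruct (classic (inc (at_gen j Y) X)) as [H|H].
- exists X; split; [split; [reflexivity|now left]|].
  symmetry. now apply agree_inc.
- destruct (lp_ax2 LP X (at_gen i X) (at_gen j Y)) as (W & [W1 W2] & _); auto.
  + apply at_gen_inc.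
  + intros H1. apply ij, (par_at_gen H1).
  + exists W; split; [apply N_tangent; now left|]. symmetry. now apply agree_inc.
Qed.

Lemma agree_A2un i j X W W' : i <> j -> touch agree i X W -> touch agree i X W' -> agree j W W' -> W = W'.
Proof.
intros ij H H' HW. destruct (classic (inc (at_gen j W) X)) as [H1|H1].
- assert (HX : agree j X W) by (symmetry; now apply agree_inc).
  rewrite <- (N_ne H HX ij). apply (N_ne H' (j := j)); auto. exact (eq_trans HX HW).
- destruct (lp_ax2 LP X (at_gen i X) (at_gen j W)) as (Z & _ & Hu); auto.
  + apply at_gen_inc.
  + intros H2. apply ij, (par_at_gen H2).
  + rewrite <- (Hu W), <- (Hu W'); auto; split.
    * now apply agree_inc.
    * apply N_single; auto. intros <-. apply H1. now apply agree_inc.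
    * apply at_gen_inc.
    * apply N_single; auto. intros <-. apply H1, at_gen_inc.
Qed.

Lemma agree_Cex i X Y : ~ agree i X Y -> exists W j, touch agree i X W /\ touch agree j W Y.
Proof.
intros H. rewrite agree_inc in H.
destruct (HC (at_gen_inc i X) H) as (W & [[_ HW] (z & [z1 z2] & z3)] & _).
exists W, (gen_of z); split; [now apply N_tangent|].
apply N_tangent. left. rewrite at_gen_of by auto. intros y; split.
- intros Hy. symmetry. now apply z3.
- intros ->; auto.
Qed.

Lemma agree_Cun i j j' X Y W W' : ~ agree i X Y -> touch agree i X W -> touch agree j W Y ->
  touch agree i X W' -> touch agree j' W' Y -> W = W'.
Proof.
intros H H1 H2 H3 H4.
assert (Hinc : ~ inc (at_gen i X) Y) by now rewrite <- agree_inc.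
destruct (HC (at_gen_inc i X) Hinc) as (Z & _ & Hu).
assert (HW : forall k V, touch agree i X V -> touch agree k V Y ->
  in_pencil inc (at_gen i X) X V /\ meet_one inc V Y).
{ intros k V V1 V2. split.
  - split; [apply at_gen_inc|now apply N_tangent].
  - assert (VY : V <> Y) by (intros ->; now apply H, N_e).
    pose proof (N_single V2 VY) as HV. exists (at_gen k V); split.
    + now apply HV.
    + intros z Hz. symmetry. now apply HV. }
rewrite <- (Hu W), <- (Hu W'); eauto.
Qed.

(** If [i], [j], [k] were all the generators, take [L] touching [K0] on [j] through [p], and [W]
    touching [K0] on [i] and meeting [L] on [k]. Then [W] and [L] could meet only on [k], so they
    would touch there, and (C) excludes such a triangle. *)
Lemma agree_fresh : (exists a b c : P, a <> b /\ b <> c /\ a <> c /\ inc a K0 /\ inc b K0 /\ inc c K0) ->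
  (exists p, ~ inc p K0) -> forall i j k : gen, exists l, l <> i /\ l <> j /\ l <> k.
Proof.
intros (a & b & c & ab & bc & ac & Ha & Hb & Hc) [p Hp].
set (i := gen_of p).
assert (Hjk : exists j k : gen, j <> i /\ k <> i /\ j <> k).
{ set (A := exist (fun x => inc x K0) a Ha). set (B := exist (fun x => inc x K0) b Hb).
  set (D := exist (fun x => inc x K0) c Hc).
  assert (A <> B) by (intros E; injection E; auto).
  assert (B <> D) by (intros E; injection E; auto).
  assert (A <> D) by (intros E; injection E; auto).
  destruct (classic (A = i)) as [<-|]; [exists B, D; auto|].
  destruct (classic (B = i)) as [<-|]; [exists A, D; auto|].
  exists A, B; auto. }
destruct Hjk as (j & k & ji & ki & jk).
assert (Hl : exists l, l <> i /\ l <> j /\ l <> k).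
{ apply NNPP; intros Hno.
  destruct (lp_ax2 LP K0 (at_gen j K0) p) as (L & [L1 L2] & _); auto.
  { apply at_gen_inc. }
  { intros H. apply ji, gen_eq. simpl. apply (pt (ps (proj2 (foot_spec (proj1_sig j) K0)))).
    apply (pt H). apply ps, foot_spec. }
  assert (HL : touch agree j K0 L) by (apply N_tangent; now left).
  assert (Hi : ~ agree i K0 L).
  { intros H. apply Hp. unfold agree in H. unfold i in H. rewrite (at_gen_of L1) in H.
    rewrite <- H. apply at_gen_inc. }
  destruct (@agree_A2ex i k K0 L) as (W & W1 & W2); auto.
  assert (W3 : touch agree k W L).
  { split; auto. right. intros l Hl. apply NNPP; intros lk.
    destruct (classic (l = i)) as [->|li].
    { apply Hi. exact (eq_trans (N_e W1) Hl). }
    destruct (classic (l = j)) as [->|lj]; [|apply Hno; eauto].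
    assert (K0 = W) as E0.
    { apply (N_ne W1 (j := j)); auto. exact (eq_trans (N_e HL) (eq_sym Hl)). }
    apply Hi. rewrite <- E0 in W2. rewrite <- (N_ne HL W2 jk). reflexivity. }
  assert (K0 = W) as E0.
  { apply (@agree_Cun i j k K0 L); auto. split; [reflexivity|now left]. }
  apply Hi. rewrite <- E0 in W2. rewrite <- (N_ne HL W2 jk). reflexivity. }
destruct Hl as (l & li & lj & lk).
intros x y z. apply NNPP; intros H.
assert (Hin : forall t, t = x \/ t = y \/ t = z).
{ intros t. apply NNPP; intros Ht. apply H. exists t. tauto. }
destruct (Hin i) as [|[|]], (Hin j) as [|[|]], (Hin k) as [|[|]], (Hin l) as [|[|]]; congruence.
Qed.

Lemma agree_circle_space : (exists a b c : P, a <> b /\ b <> c /\ a <> c /\ inc a K0 /\ inc b K0 /\ inc c K0) ->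
  (exists p, ~ inc p K0) -> circle_space agree.
Proof.
intros H3 Hp. constructor.
- reflexivity.
- intros i X Y H; exact (eq_sym H).
- intros i X Y Z H H'; exact (eq_trans H H').
- destruct Hp as [p _]. exact (inhabits (gen_of p)).
- now apply agree_fresh.
- intros i j k X Y Z ij jk ik.
  destruct (lp_ax1 LP (at_gen i X) (at_gen j Y) (at_gen k Z)) as (W & (W1 & W2 & W3) & _).
  1-3: intros H; apply par_at_gen in H; auto.
  exists W; repeat split; symmetry; now apply agree_inc.
- intros i j k X Y ij jk ik Hi Hj Hk.
  destruct (lp_ax1 LP (at_gen i X) (at_gen j X) (at_gen k X)) as (W & _ & Hu).
  1-3: intros H; apply par_at_gen in H; auto.
  rewrite <- (Hu X), <- (Hu Y); auto; repeat split; try apply at_gen_inc; now apply agree_inc.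
- apply agree_A2ex.
- apply agree_A2un.
- apply agree_Cex.
- apply agree_Cun.
- intros a b c d K L M X KL LM MX XK Ha Hb Hc Hd ac.
  destruct (HS (N_single Ha KL) (N_single Hb LM) (N_single Hc MX) (N_single Hd XK))
    as (O & O1 & O2 & O3 & O4).
  { intros H. apply ac, (par_at_gen H). }
  exists O; repeat split; symmetry; now apply agree_inc.
Qed.

(** Allows a map on points to be defined from one on circles. *)
Lemma circle_through a b p : a <> b -> inc a K0 -> inc b K0 -> exists X, inc p X.
Proof.
intros ab Ha Hb. destruct (classic (inc p K0)) as [|Hp]; [eauto|].
assert (exists x, inc x K0 /\ ~ par x p) as (x & Hx & Hxp).
{ apply NNPP; intros H. apply ab. transitivity (foot p K0).
  - apply foot_unique; auto. apply NNPP; eauto.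
  - symmetry. apply foot_unique; auto. apply NNPP; eauto. }
destruct (lp_ax2 LP K0 x p) as (W & [HW _] & _); eauto.
Qed.

End Plane.

(** * The map on points induced by the circle reflection *)

Theorem theorem3p1 (P C : Type) (par : P -> P -> Prop) (inc : P -> C -> Prop) :
  laguerre_plane par inc -> axiom_C inc -> axiom_S par inc ->
  forall K L : C, ~ tangent inc K L ->
  exists phi : P -> P,
    automorphism inc phi /\ involutory phi /\
    (forall x, inc x K -> is_xKL inc K L x (phi x)) /\
    (forall x (M : C), phi x <> x -> inc x M -> inc (phi x) M ->
       fixes_circle inc phi M).
Proof.
intros LP HC HS K L HKL.
destruct (lp_ax4 LP) as (K0 & H3 & Hp).
assert (Hfoot : forall pK : P * C, exists q, inc q (snd pK) /\ par q (fst pK)).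
{ intros [p X]. destruct (lp_ax3 LP p X) as (q & Hq & _). now exists q. }
destruct (choice _ Hfoot) as (ft & Hft); clear Hfoot.
set (foot p X := ft (p, X)).
assert (foot_spec : forall p X, inc (foot p X) X /\ par (foot p X) p).
{ intros p X. apply (Hft (p, X)). }
pose proof (agree_circle_space LP HC HS foot foot_spec K0 H3 Hp) as A.
destruct (@circle_reflection C (gen inc K0) (agree foot (K0 := K0)) K L A)
  as (f & tau & ff & tt & fe & fK & Hfix & Htau & Hmov & Hstay).
{ intros i Hi. apply HKL. eexists. apply (N_tangent LP foot foot_spec), Hi. }
assert (Hcirc : forall p, exists X, inc p X).
{ intros p. destruct H3 as (a & b & _ & ab & _ & _ & Ha & Hb & _).
  exact (circle_through LP foot foot_spec K0 p ab Ha Hb). }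
destruct (choice _ Hcirc) as (circ & Hc).
set (gn := @gen_of P C par inc foot foot_spec K0).
set (on (i : gen inc K0) X := at_gen foot i X).
assert (on_inc : forall i X, inc (on i X) X) by (intros; apply (at_gen_inc par foot foot_spec)).
assert (on_gn : forall p X, inc p X -> on (gn p) X = p).
{ intros p X. apply (at_gen_of LP foot foot_spec). }
assert (gn_on : forall i X, gn (on i X) = i).
{ intros i X. apply (par_at_gen LP foot foot_spec _ _ X X).
  fold (on (gn (on i X)) X) (on i X). rewrite on_gn by auto. apply (lp_par_refl LP). }
(* Any circle through [p] gives the same image, as [key] shows, because [f] and [tau] respect
   [agree]. *)
set (phi p := on (tau (gn p)) (f (circ p))).
assert (key : forall i X, phi (on i X) = on (tau i) (f X)).
{ intros i X. unfold phi. rewrite gn_on. apply fe. unfold agree.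
  fold (on i X) (on i (circ (on i X))). rewrite <- (gn_on i X) at 1. now apply on_gn. }
assert (phiphi : forall p, phi (phi p) = p).
{ intros p. unfold phi at 2. rewrite key, tt, ff. now apply on_gn. }
assert (phi_inc : forall p X, inc p X -> inc (phi p) (f X)).
{ intros p X H. rewrite <- (on_gn p X H), key. apply on_inc. }
assert (image : forall M, circle_image inc phi M (f M)).
{ intros M y; split.
  - intros Hy. exists (phi y). rewrite phiphi. split; auto. rewrite <- (ff M). auto.
  - intros (x & Hx & <-). auto. }
exists phi. split; [|split; [|split]].
- split; [|split; [|split]].
  + intros x y H. now rewrite <- (phiphi x), <- (phiphi y), H.
  + intros y. exists (phi y). auto.
  + intros M. exists (f M). auto.
  + intros M. exists (f M). rewrite <- (ff M) at 2. auto.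
- exact phiphi.
- intros x Hx. rewrite <- (on_gn x K Hx). set (i := gn x). rewrite key, fK.
  destruct (classic (inc (on i K) L)) as [H|H]; [left; split; auto|right; split; auto].
  + assert (Hi : agree foot i K L) by now apply (agree_inc LP foot foot_spec).
    rewrite Hfix by exact Hi. symmetry. exact Hi.
  + assert (Hi : ~ agree foot i K L).
    { intros Hi. apply H. now apply (agree_inc LP foot foot_spec). }
    (* [M] touches [K] on [i] and [L] on [j], and [tau] takes [i] to [j]; so the image is the
       contact of [M] and [L]. *)
    destruct (Cex A i K L Hi) as (M & j & M1 & M2). exists M.
    assert (ML : M <> L) by (intros ->; now apply Hi, N_e).
    assert (ij : i <> j).
    { intros <-. apply Hi. exact (eq_trans (N_e M1) (N_e M2)). }
    rewrite (Htau i j M M1 M2 ij). split.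
    * split; [apply on_inc|]. now apply (N_tangent LP foot foot_spec).
    * unfold on. rewrite <- (N_e M2). now apply (N_single LP foot_spec).
- intros x M Hx H1 H2. set (i := gn x).
  assert (Ex : x = on i M) by (symmetry; now apply on_gn).
  assert (Ep : phi x = on (tau i) (f M)) by (rewrite Ex at 1; apply key).
  (* Every circle meets its image on a generator fixed by [tau], which would make [x] a fixed
     point. *)
  assert (ti : tau i <> i).
  { intros ti. apply Hx. rewrite Ep, ti, Ex. symmetry. exact (Hstay i M ti). }
  assert (fM : f M = M).
  { apply (Hmov i); auto. apply eq_sym. apply (agree_inc LP foot foot_spec).
    change (inc (on (tau i) (f M)) M). rewrite <- Ep. exact H2. }
  unfold fixes_circle. rewrite <- fM at 2. apply image.
Qed.
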